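(* Let $m,n$ be positive integers and let $\mathbf{r}=(r_1,\dots,r_m)\in\mathbb{R}^m$, $\mathbf{s}=(s_1,\dots,s_n)\in\mathbb{R}^n$ satisfy $r_i,s_j>0$ and $\sum_{i=1}^mr_i=1=\sum_{j=1}^ns_j$. Then the set $\mathbf{Bad}(\mathbf{r},\mathbf{s})\subset M_{m,n}$ is winning for the modified Schmidt game (MSG) induced by the semigroup of contractions $\Phi_t:(y_{ij})\mapsto(e^{-(r_i+s_j)t}y_{ij})$, $t>0$, of $M_{m,n}$.
   Context: $M_{m,n}$ is the (additive) group of real $m\times n$ matrices. A matrix $Y\in M_{m,n}$ with rows $Y_1,\dots,Y_m$ belongs to $\mathbf{Bad}(\mathbf{r},\mathbf{s})$ if $$\inf_{\mathbf{p}\in\mathbb{Z}^m,\ \mathbf{q}\in\mathbb{Z}^n\smallsetminus\{0\}}\ \max_i|Y_i\mathbf{q}-p_i|^{1/r_i}\cdot\max_j|q_j|^{1/s_j}>0,$$ where $Y_i\mathbf{q}$ is the product of the row $Y_i$ with the column vector $\mathbf{q}$. Modified Schmidt games. Let $H$ be a connected Lie group (here $H=M_{m,n}$) and $\{\Phi_t:t\in\mathbb{R}\}$ a one-parameter group of automorphisms of $H$ such that $\Phi_t$ is contracting for $t>0$ (that is, $\Phi_t^k(h)\to e$ as $k\to\infty$ for every $h\in H$); put $\mathcal{F}=\{\Phi_t:t>0\}$. A set $D_0\subset H$ is admissible if it is compact with non-empty interior. Given an admissible $D_0$, let $\mathcal{D}_t=\{\Phi_t(D_0)h:h\in H\}$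 for $t\in\mathbb{R}$ (translates of $\Phi_t(D_0)$), and fix $a_*$ such that for every $t>a_*$ some element of $\mathcal{D}_t$ is contained in $D_0$ (such $a_*$ exists). For $a,b>a_*$ the game is: Bob picks $t_1\in\mathbb{R}$ and $B_1\in\mathcal{D}_{t_1}$; with $t_k=t_1+(k-1)(a+b)$ and $t_k'=t_k+a$, at step $k\geq 1$ Alice picks $A_k\in\mathcal{D}_{t_k'}$ with $A_k\subset B_k$, and then Bob picks $B_{k+1}\in\mathcal{D}_{t_{k+1}}$ with $B_{k+1}\subset A_k$. The intersection $\bigcap_k A_k=\bigcap_k B_k$ is a single point. A set $S\subset H$ is $(a,b)$-winning if Alice can play so that this point lies in $S$ no matter how Bob plays; $S$ is $a$-winning (where $a>a_*$) if it is $(a,b)$-winning for every $b>a_*$; $S$ is winning if it is $a$-winning for some $a>a_*$. The MSG induced by $\mathcal{F}$ is this game for some fixed admissible $D_0$; the game and the value of $a_*$ depend on $D_0$, but the class of winning sets does not. *)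

(* Defs.v *)
From mathcomp Require Import all_boot all_order all_algebra.
From mathcomp Require Import all_classical all_reals all_analysis.

Set Implicit Arguments.
Unset Strict Implicit.
Unset Printing Implicit Defensive.

Import Order.TTheory GRing.Theory Num.Theory.
Import numFieldTopology.Exports numFieldNormedType.Exports.

Local Open Scope classical_set_scope.
Local Open Scope ring_scope.

(** In the definitions of the modified Schmidt game, the group [H] is
    written additively, as it is abelian in the application to real matrices.
    Steps of the game are numbered from [0]. *)

Definition admissible (H : topologicalType) (D0 : set H) : Prop :=
  compact D0 /\ interior D0 !=set0.

Definition translates (R : realType) (H : zmodType) (Phi : R -> H -> H)
    (D0 : set H) (t : R) : set (set H) :=
  [set [set x + h | x in Phi t @` D0] | h in setT].

Definition msg_threshold (R : realType) (H : zmodType) (Phi : R -> H -> H)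
    (D0 : set H) (astar : R) : Prop :=
  forall t : R, astar < t ->
    exists2 E : set H, translates Phi D0 t E & E `<=` D0.

Definition bob_time (R : realType) (a b t1 : R) (k : nat) : R :=
  t1 + k%:R * (a + b).

Definition alice_time (R : realType) (a b t1 : R) (k : nat) : R :=
  bob_time a b t1 k + a.

Definition bob_legal (R : realType) (H : zmodType) (Phi : R -> H -> H)
    (D0 : set H) (a b t1 : R) (A B : nat -> set H) (k : nat) : Prop :=
  translates Phi D0 (bob_time a b t1 k) (B k) /\
  (if k is j.+1 then B k `<=` A j else True).

Definition alice_legal (R : realType) (H : zmodType) (Phi : R -> H -> H)
    (D0 : set H) (a b t1 : R) (A B : nat -> set H) (k : nat) : Prop :=
  translates Phi D0 (alice_time a b t1 k) (A k) /\ A k `<=` B k.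

(** A strategy of Alice maps Bob's initial [t1] and his moves [B_0, ..., B_k]
    to her answer [A_k].  It must answer legally as long as Bob has played
    legally, and produce an outcome in [S] if Bob plays legally forever. *)
Definition ab_winning (R : realType) (H : zmodType) (Phi : R -> H -> H)
    (D0 : set H) (a b : R) (S : set H) : Prop :=
  exists sigma : R -> seq (set H) -> set H,
  forall (t1 : R) (B : nat -> set H),
    let A := fun k : nat => sigma t1 (mkseq B k.+1) in
    (forall k : nat,
       (forall j : nat, (j <= k)%N -> bob_legal Phi D0 a b t1 A B j) ->
       alice_legal Phi D0 a b t1 A B k) /\
    ((forall k : nat, bob_legal Phi D0 a b t1 A B k) ->
       exists2 x : H, \bigcap_k A k = [set x] & S x).

Definition a_winning (R : realType) (H : zmodType) (Phi : R -> H -> H)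
    (D0 : set H) (astar a : R) (S : set H) : Prop :=
  forall b : R, astar < b -> ab_winning Phi D0 a b S.

Definition winning (R : realType) (H : zmodType) (Phi : R -> H -> H)
    (D0 : set H) (astar : R) (S : set H) : Prop :=
  exists2 a : R, astar < a & a_winning Phi D0 astar a S.

Definition weight_flow (R : realType) (m n : nat) (r : 'I_m -> R)
    (s : 'I_n -> R) (t : R) (Y : 'M[R]_(m, n)) : 'M[R]_(m, n) :=
  \matrix_(i < m, j < n) (expR (- (r i + s j) * t) * Y i j).

(** The maxima are over nonnegative reals, hence the default value [0]. *)
Definition approx_quality (R : realType) (m n : nat) (r : 'I_m -> R)
    (s : 'I_n -> R) (Y : 'M[R]_(m, n)) (p : 'cV[int]_m) (q : 'cV[int]_n) : R :=
  (\big[Num.max/0]_(i < m)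
     (`| (row i Y *m map_mx intr q) 0 0 - (p i 0)%:~R | `^ (1 / r i))) *
  (\big[Num.max/0]_(j < n) (`| (q j 0)%:~R | `^ (1 / s j))).

(** The set is nonempty and bounded below by [0] when [n] is positive, so that
    the real-valued [inf] is then the actual infimum. *)
Definition Bad (R : realType) (m n : nat) (r : 'I_m -> R) (s : 'I_n -> R) :
    set 'M[R]_(m, n) :=
  [set Y | 0 < inf [set x : R | exists (p : 'cV[int]_m) (q : 'cV[int]_n),
                       q != 0 /\ x = approx_quality r s Y p q]].

(* Main.v *)
Require Import Defs.
From mathcomp Require Import all_boot all_order all_algebra.
From mathcomp Require Import all_classical all_reals all_analysis.
From mathcomp Require Import perm ring lra zify.

(** Write [d = m + n].  A matrix [Y] is in [Bad] as soon as the trajectory of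
    the unimodular lattice [lattice_mx r s t Y *m Z^d] stays bounded (Dani
    correspondence), and the game is compatible with the diagonal flow: moving
    the centre of a ball by [weight_flow r s t Z] at time [t] multiplies the
    renormalized lattice by [uni Z].

    Alice keeps, at all of Bob's turns, the covolume of every subgroup of rank
    [j] above [exp (- M j (d - j))].  Say that a subgroup is short if a single
    round could make it violate this bound.  By submodularity of the covolume
    (for the sum and the intersection of two subgroups) and strict concavity of
    [j (d - j)], when [M] is large there is at most one rational subspace of
    each dimension [j] containing short subgroups of rank [j].  Alice only has
    to make sure that these at most [d - 1] subspaces are not contracted: a
    small translation makes the components of their exterior powers along
    expanded directions comparable to the whole vectors, by constants that do
    not depend on the subspaces, and a fixed [a] then suffices to compensate
    for these constants.  Bob cannot spoil this, since expanded components keep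
    growing during his moves. *)

Set Implicit Arguments.
Unset Strict Implicit.
Unset Printing Implicit Defensive.

Import Order.TTheory GRing.Theory Num.Theory.
Import numFieldTopology.Exports numFieldNormedType.Exports.
Local Open Scope ring_scope.

(** * Maximal minors and unipotent row operations *)

(** This is the sup norm of the exterior product of the columns; it serves as the covolume of the
    subgroup they generate. Allowing all functions [f] instead of increasing ones only adds zero
    minors and repetitions up to sign. *)
Definition max_minor (R : realFieldType) (d j : nat) (X : 'M[R]_(d, j)) : R :=
  \big[Num.max/0]_(f : {ffun 'I_j -> 'I_d}) `|\det (rowsub f X)|.

Lemma max_minor_ge0 (R : realFieldType) (d j : nat) (X : 'M[R]_(d, j)) :
  0 <= max_minor X.
Proof.
rewrite /max_minor; elim/big_ind: _ => // x y x0 y0.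
by rewrite le_max x0.
Qed.

Lemma minor_le (R : realFieldType) (d j : nat) (X : 'M[R]_(d, j))
    (f : {ffun 'I_j -> 'I_d}) : `|\det (rowsub f X)| <= max_minor X.
Proof. exact: (le_bigmax_cond _ (fun f : {ffun _} => `|\det (rowsub f X)|)). Qed.

Lemma max_minor_le (R : realFieldType) (d j : nat) (X : 'M[R]_(d, j)) (c : R) :
  0 <= c -> (forall f : {ffun 'I_j -> 'I_d}, `|\det (rowsub f X)| <= c) ->
  max_minor X <= c.
Proof. by move=> c0 h; apply: bigmax_le. Qed.

Lemma max_minor_attained (R : realFieldType) (d j : nat) (X : 'M[R]_(d, j)) :
  0 < max_minor X ->
  exists f : {ffun 'I_j -> 'I_d}, max_minor X = `|\det (rowsub f X)|.
Proof.
rewrite /max_minor => h.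
case: (pickP (fun f : {ffun 'I_j -> 'I_d} => true)) => [f0 _|no]; last first.
  by move: h; rewrite big_pred0 ?ltxx.
have [f _ ->] := @eq_bigmax _ _ _ (0 : R) f0 xpredT
  (fun f : {ffun 'I_j -> 'I_d} => `|\det (rowsub f X)|) isT (fun _ _ => normr_ge0 _).
by exists f.
Qed.

Lemma max_minor_mulmx (R : realFieldType) (d j : nat) (X : 'M[R]_(d, j)) (Q : 'M[R]_j) :
  max_minor (X *m Q) = max_minor X * `|\det Q|.
Proof.
rewrite /max_minor.
elim/big_ind2: _ => [|x1 x2 y1 y2 -> ->|f _]; first by rewrite mul0r.
  by rewrite maxr_pMl.
by rewrite -mul_rowsub_mx det_mulmx normrM.
Qed.

Lemma max_minor_gt0 (R : realFieldType) (d j : nat) (X : 'M[R]_(d, j)) :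
  (0 < max_minor X) = row_full X.
Proof.
apply/idP/idP => [/[dup] h /max_minor_attained [f e]|full].
  move: h; rewrite e normr_gt0 => h.
  have u : rowsub f X \in unitmx by rewrite unitmxE unitfE.
  apply/row_fullP; exists (invmx (rowsub f X) *m rowsub f 1%:M).
  by rewrite -mulmxA mul_rowsub_mx mul1mx mulVmx.
apply: (lt_le_trans _ (minor_le X (fullrankfun full))).
by rewrite normr_gt0 -unitfE -unitmxE fullrowsub_unit.
Qed.

Lemma det_rowsub_noninj (R : comPzRingType) (d j : nat) (X : 'M[R]_(d, j))
    (f : 'I_j -> 'I_d) (k l : 'I_j) :
  k != l -> f k = f l -> \det (rowsub f X) = 0.
Proof. by move=> kl e; apply: (determinant_alternate kl) => q; rewrite !mxE e. Qed.

Lemma det_rowsub_inj (R : comPzRingType) (d j : nat) (X : 'M[R]_(d, j))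
    (f : 'I_j -> 'I_d) : \det (rowsub f X) != 0 -> injective f.
Proof.
move=> h k l e; apply/eqP; apply: contraNT h => kl.
by rewrite (det_rowsub_noninj X kl e).
Qed.

Definition upd (d j : nat) (f : {ffun 'I_j -> 'I_d}) (k : 'I_j) (x : 'I_d) :
    {ffun 'I_j -> 'I_d} := [ffun l => if l == k then x else f l].

Definition add_row (R : pzRingType) (d j : nat) (x y : 'I_d) (c : R)
    (X : 'M[R]_(d, j)) : 'M[R]_(d, j) := X + c *: (delta_mx x y *m X).

Lemma add_rowE (R : pzRingType) (d j : nat) (x y : 'I_d) (c : R) (X : 'M[R]_(d, j)) a b :
  add_row x y c X a b = X a b + (if a == x then c * X y b else 0).
Proof.
rewrite !mxE (bigD1 y)//= big1 => [|z zy]; rewrite !mxE ?eqxx ?(negPf zy) ?andbF ?mul0r//.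
by rewrite andbT addr0; case: (a == x); rewrite ?mul1r // mul0r mulr0.
Qed.

Lemma det_rowsub_add_row (R : comPzRingType) (d j : nat) (x y : 'I_d) (c : R)
    (X : 'M[R]_(d, j)) (f : {ffun 'I_j -> 'I_d}) (k : 'I_j) :
  f k = x -> (forall l, l != k -> f l != x) ->
  \det (rowsub f (add_row x y c X)) =
  \det (rowsub f X) + c * \det (rowsub (upd f k y) X).
Proof.
move=> fk fl; move: (add_row x y c X) (add_rowE x y c X) => Z ZE.
rewrite -[\det (rowsub f X)]mul1r; apply: (@determinant_multilinear _ _ _ _ _ k).
- by apply/rowP => b; rewrite !mxE ZE ffunE eqxx fk eqxx mul1r.
- apply/matrixP => a b; rewrite !mxE ZE (negPf (fl _ _)) ?addr0//.
  by rewrite eq_sym neq_lift.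
- apply/matrixP => a b; rewrite !mxE ZE ffunE.
  have h : lift k a != k by rewrite eq_sym neq_lift.
  by rewrite (negPf h) (negPf (fl _ h)) addr0.
Qed.

(** If [f] avoids [x] the minor is unchanged, if [f] takes the value [x] twice both minors vanish,
    and otherwise multilinearity in the single affected row applies. *)
Lemma minor_add_row_dist (R : realFieldType) (d j : nat) (x y : 'I_d) (c : R)
    (X : 'M[R]_(d, j)) (f : {ffun 'I_j -> 'I_d}) :
  `|\det (rowsub f (add_row x y c X)) - \det (rowsub f X)| <= `|c| * max_minor X.
Proof.
move: (add_row x y c X) (add_rowE x y c X)
  (fun k => @det_rowsub_add_row _ _ _ x y c X f k) => Z ZE Zdet.
have rhs0 : 0 <= `|c| * max_minor X by rewrite mulr_ge0 ?max_minor_ge0.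
case: (pickP (fun k => f k == x)) => [k /eqP fk|no]; last first.
  rewrite [X in X - _](_ : _ = \det (rowsub f X)) ?subrr ?normr0//.
  by congr determinant; apply/matrixP => a b; rewrite !mxE ZE no addr0.
case: (pickP (fun l => (l != k) && (f l == x))) => [l /andP[lk /eqP fl]|no].
  by rewrite !(det_rowsub_noninj _ lk) ?fl ?fk// subrr normr0.
rewrite (Zdet k) // => [|l lk]; last first.
  by have := no l; rewrite lk /= => ->.
by rewrite addrAC subrr add0r normrM ler_wpM2l // minor_le.
Qed.

Definition uni (R : pzRingType) (m n : nat) (Y : 'M[R]_(m, n)) : 'M[R]_(m + n) :=
  block_mx 1%:M Y 0 1%:M.

Lemma uniD (R : pzRingType) (m n : nat) (Y Z : 'M[R]_(m, n)) :
  uni (Y + Z) = uni Y *m uni Z.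
Proof.
by rewrite /uni mulmx_block !mul1mx !mulmx1 !mul0mx !mulmx0 addr0 !add0r addrC.
Qed.

Lemma uni0 (R : pzRingType) (m n : nat) : uni (0 : 'M[R]_(m, n)) = 1%:M.
Proof. by rewrite /uni -scalar_mx_block. Qed.

Lemma det_uni (R : comPzRingType) (m n : nat) (Y : 'M[R]_(m, n)) : \det (uni Y) = 1.
Proof. by rewrite det_ublock !det1 mulr1. Qed.

Lemma uni_delta (R : comPzRingType) (m n j : nat) (i : 'I_m) (q : 'I_n) (c : R)
    (X : 'M[R]_(m + n, j)) :
  uni (c *: delta_mx i q) *m X = add_row (lshift n i) (rshift m q) c X.
Proof.
rewrite /add_row -{2}[X]mul1mx scalemxAl -mulmxDl; congr (_ *m _).
rewrite /uni scalar_mx_block.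
have -> : delta_mx (lshift n i) (rshift m q) = block_mx 0 (delta_mx i q) 0 0 :> 'M[R]_(m + n).
  apply/matrixP => a b; rewrite -[a]splitK -[b]splitK.
  case: (fintype.split a) => a'; case: (fintype.split b) => b' /=;
    rewrite ?block_mxEul ?block_mxEur ?block_mxEdl ?block_mxEdr !mxE //
      ?eq_lshift ?eq_rshift ?eq_lrshift ?eq_rlshift ?andbF //.
by rewrite scale_block_mx add_block_mx !scaler0 !addr0 add0r.
Qed.

(** Since [uni] turns sums into products, the matrix is a product of elementary row operations, each
    of which moves every minor by at most [c] times the current maximum. *)
Lemma uni_near_seq (R : realFieldType) (m n j : nat) (Y : 'M[R]_(m, n)) (c : R)
    (s : seq ('I_m * 'I_n)) (X : 'M[R]_(m + n, j)) :
  0 <= c -> (forall i q, `|Y i q| <= c) ->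
  let Z := uni (\sum_(p <- s) Y p.1 p.2 *: delta_mx p.1 p.2) *m X in
  max_minor Z <= (1 + c) ^+ size s * max_minor X /\
  (c <= 1 -> forall f : {ffun 'I_j -> 'I_(m + n)},
     `|\det (rowsub f Z) - \det (rowsub f X)| <= c * 2 ^+ size s * max_minor X).
Proof.
move=> c0 Yc; elim: s => [|[i q] s [IH1 IH2]] /=.
  rewrite big_nil uni0 mul1mx mul1r; split => // _ f.
  by rewrite subrr normr0 mulr1 mulr_ge0 ?max_minor_ge0.
rewrite big_cons uniD -mulmxA uni_delta /=.
set Z := uni _ *m X in IH1 IH2 *.
have step (f : {ffun _}) : `|\det (rowsub f (add_row (lshift n i) (rshift m q) (Y i q) Z)) -
    \det (rowsub f Z)| <= c * max_minor Z.
  apply: le_trans (minor_add_row_dist _ _ _ _ _) _.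
  by rewrite ler_wpM2r ?max_minor_ge0.
have c1 : 0 <= 1 + c by rewrite addr_ge0.
split.
  rewrite exprS -mulrA; apply: le_trans (ler_wpM2l c1 IH1).
  apply: max_minor_le => [|f]; first by rewrite mulr_ge0 ?max_minor_ge0.
  rewrite -(subrK (\det (rowsub f Z)) (\det _)).
  apply: le_trans (ler_normD _ _) _; rewrite mulrDl mul1r addrC.
  by rewrite lerD ?minor_le.
move=> c_le1 f; rewrite -(subrK (\det (rowsub f Z)) (\det _)) -addrA.
apply: le_trans (ler_normD _ _) _.
rewrite exprS mulrCA -mulrA mulr_natl mulr2n lerD ?IH2 //.
apply: le_trans (step f) _; rewrite -mulrA ler_wpM2l //.
apply: le_trans IH1 _; rewrite ler_wpM2r ?max_minor_ge0 // lerXn2r ?nnegrE //.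
by rewrite -[2]/(1 + 1) lerD2l.
Qed.

Lemma uni_near (R : realFieldType) (m n j : nat) (Y : 'M[R]_(m, n)) (c : R)
    (X : 'M[R]_(m + n, j)) :
  0 <= c -> (forall i q, `|Y i q| <= c) ->
  let N := #|{: 'I_m * 'I_n}| in
  max_minor (uni Y *m X) <= (1 + c) ^+ N * max_minor X /\
  (c <= 1 -> forall f : {ffun 'I_j -> 'I_(m + n)},
     `|\det (rowsub f (uni Y *m X)) - \det (rowsub f X)| <= c * 2 ^+ N * max_minor X).
Proof.
move=> c0 Yc; have := uni_near_seq (index_enum _) X c0 Yc.
have -> : \sum_p Y p.1 p.2 *: delta_mx p.1 p.2 = Y.
  by rewrite [RHS]matrix_sum_delta pair_bigA.
by rewrite /= /index_enum -enumT -cardE.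
Qed.

(** * Pushing a minor towards the expanded rows *)

(** The row indices below [m] are those expanded by the flow. An injective [f] has count at most
    [minn j m], and the lemmas below look for minors reaching this value. *)
Definition left_count (m n j : nat) (f : 'I_j -> 'I_(m + n)) : nat :=
  #|[set k | (f k < m)%N]|.

Lemma left_count_missing (m n j : nat) (f : 'I_j -> 'I_(m + n)) :
  (left_count f < m)%N -> exists i : 'I_m, forall l, f l != lshift n i.
Proof.
move=> h; case: (pickP (fun i : 'I_m => [forall l, f l != lshift n i])) => [i /forallP|no].
  by exists i.
suff : (m <= left_count f)%N by rewrite leqNgt h.
have : lshift n @: [set: 'I_m] \subset f @: [set k | (f k < m)%N].
  apply/fintype.subsetP => x /imsetP[i _ ->].
  have /negbT := no i; rewrite negb_forall => /existsP[l /negPn/eqP e].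
  by apply/imsetP; exists l; rewrite // inE e /= ltn_ord.
move=> /subset_leq_card; rewrite (card_imset _ (@lshift_inj m n)) cardsT card_ord.
by move=> /leq_trans; apply; apply: leq_imset_card.
Qed.

Lemma left_count_right (m n j : nat) (f : 'I_j -> 'I_(m + n)) :
  (left_count f < j)%N -> exists k q, f k = rshift m q.
Proof.
move=> h; case: (pickP (fun k : 'I_j => ~~ (f k < m)%N)) => [k|no].
  by case: (split_ordP (f k)) => // q e _; exists k, q.
suff e : left_count f = j by rewrite e ltnn in h.
rewrite /left_count -[RHS]card_ord -cardsT; apply: eq_card => k.
by rewrite !inE; have /negbFE := no k.
Qed.

(* If row [lshift i] is not used by the minor [f] but row [rshift q] is, then
   adding [c] times the latter row to the former changes the minor of the
   exchanged index set by [c * \det (rowsub f X)], so that some small [c] makes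
   it comparable to the minor of [f]. *)
Lemma push_minor_left (R : realFieldType) (m n j : nat) (rho : R) (s : nat)
    (X : 'M[R]_(m + n, j)) (f : {ffun 'I_j -> 'I_(m + n)}) :
  0 < rho <= 1 -> (minn j m <= left_count f + s)%N ->
  exists (Y : 'M[R]_(m, n)) (g : {ffun 'I_j -> 'I_(m + n)}),
  [/\ forall i q, `|Y i q| <= s%:R * rho,
      (rho / 2) ^+ s * `|\det (rowsub f X)| <= `|\det (rowsub g (uni Y *m X))|
    & (minn j m <= left_count g)%N].
Proof.
move=> /andP[rho0 rho1]; have r2 : 0 <= rho / 2 <= 1 by lra.
elim: s X f => [|s IH] X f h.
  exists 0, f; rewrite uni0 mul1mx addn0 in h *; split => //.
    by move=> i q; rewrite mxE normr0 mul0r.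
  by rewrite expr0 mul1r.
have [h'|h'] := leqP (minn j m) (left_count f + s).
  have [Y [g [Y1 Y2 Y3]]] := IH X f h'; exists Y, g; split => // [i q|].
    by apply: le_trans (Y1 i q) _; rewrite ler_wpM2r ?ler_nat // ltW.
  apply: le_trans Y2; rewrite ler_wpM2r // exprS ler_piMl ?exprn_ge0 //; lra.
have {}h' := leq_ltn_trans (leq_addr s _) h'.
move: h'; rewrite leq_min => /andP[/left_count_right[k [q fk]] /left_count_missing[i fi]].
pose g := upd f k (lshift n i).
have cg : left_count g = (left_count f).+1.
  rewrite /left_count (cardsD1 k) inE ffunE eqxx /= ltn_ord add1n; congr _.+1.
  apply: eq_card => l; rewrite !inE ffunE.
  by case: eqVneq => [->|]//; rewrite fk /= ltnNge leq_addr.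
(* The candidates [0] and [rho] cannot both fail, because the two resulting values differ by [rho]
   times the minor of [f]. *)
have [c [c0 cr cdet]] : exists c, [/\ 0 <= c, c <= rho &
   rho / 2 * `|\det (rowsub f X)| <= `|\det (rowsub g X) + c * \det (rowsub f X)|].
  have [le|lt] := lerP (rho / 2 * `|\det (rowsub f X)|) `|\det (rowsub g X)|.
    by exists 0; rewrite mul0r addr0 lexx ltW.
  exists rho; split; rewrite ?lexx 1?ltW //.
  have := ler_normB (\det (rowsub g X) + rho * \det (rowsub f X)) (\det (rowsub g X)).
  rewrite addrAC subrr add0r normrM gtr0_norm //; lra.
have edet : \det (rowsub g (uni (c *: delta_mx i q) *m X)) =
    \det (rowsub g X) + c * \det (rowsub f X).
  rewrite uni_delta (@det_rowsub_add_row _ _ _ _ _ _ _ _ k) ?ffunE ?eqxx // => [|l lk].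
    congr (_ + _ * \det _); apply/matrixP => a b; rewrite !mxE !ffunE.
    by case: eqVneq => [->|]//; rewrite fk.
  by rewrite ffunE (negPf lk).
have {}h : (minn j m <= left_count g + s)%N by rewrite cg addSnnS.
have [Y [g' [Y1 Y2 Y3]]] := IH (uni (c *: delta_mx i q) *m X) g h.
exists (Y + c *: delta_mx i q), g'; split => //.
- move=> a b; rewrite mxE -natr1 mulrDl mul1r.
  apply: le_trans (ler_normD _ _) _; rewrite lerD // !mxE normrM ger0_norm //.
  by case: (_ && _); rewrite ?normr1 ?normr0 ?mulr1 ?mulr0 // ltW.
- rewrite uniD -mulmxA; apply: le_trans Y2; rewrite edet exprSr -mulrA.
  by rewrite ler_wpM2l ?exprn_ge0 //; case/andP: r2.
Qed.

(** A largest minor of [X] is pushed to the expanded rows, and the inequality survives on a box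
    around [Y] by [uni_near]. The constants come before [j] and [X], so they are uniform over all
    subgroups. *)
Lemma open_push (R : realFieldType) (m n : nat) (rho : R) :
  0 < rho <= 1 -> exists c eta : R, [/\ 0 < c, 0 < eta &
  forall j (X : 'M[R]_(m + n, j)), row_full X ->
  exists Y : 'M[R]_(m, n), (forall i q, `|Y i q| <= rho) /\
  forall Z : 'M[R]_(m, n), (forall i q, `|Z i q - Y i q| <= eta) ->
  exists f : {ffun 'I_j -> 'I_(m + n)}, (minn j m <= left_count f)%N /\
    c * max_minor X <= `|\det (rowsub f (uni Z *m X))|].
Proof.
move=> /andP[rho0 rho1]; set N := #|{: 'I_m * 'I_n}|.
(* At most [m] exchanges occur, each moving [Y] by at most [r], so that the total stays within
   [rho]. *)
pose r := rho / m.+1%:R; have m0 : 0 < m.+1%:R :> R by rewrite ltr0n.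
have r0 : 0 < r by rewrite divr_gt0.
have rr : m.+1%:R * r = rho by rewrite mulrC divfK // gt_eqF.
have r1 : r <= rho by rewrite -rr ler_peMl ?ler1n // ltW.
have r01 : 0 < r <= 1 by lra.
pose c := (r / 2) ^+ m.
have c0 : 0 < c by apply: exprn_gt0; apply: divr_gt0.
have c1 : c <= 1 by apply: exprn_ile1; lra.
have p0 : 0 < 2 ^+ N * 2 ^+ N :> R by rewrite mulr_gt0 ?exprn_gt0.
have p1 : 1 <= 2 ^+ N * 2 ^+ N :> R by rewrite mulr_ege1 // exprn_ege1 // ler1n.
(* One factor [2 ^+ N] bounds the growth of the minors under [uni Y], the other comes from the
   perturbation of [Y] into [Z]; the error is then at most half of [c * max_minor X]. *)
pose eta := c / 2 / (2 ^+ N * 2 ^+ N).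
have eta0 : 0 < eta by rewrite !divr_gt0.
have eta1 : eta <= 1.
  rewrite /eta ler_pdivrMr // mul1r; apply: le_trans p1; lra.
exists (c / 2), eta; split => //; first by rewrite divr_gt0.
move=> j X full.
have [f ef] := max_minor_attained (etrans (max_minor_gt0 X) full).
have hm : (minn j m <= left_count f + m)%N by rewrite geq_min leq_addl orbT.
have [Y [g [Y1 Y2 Y3]]] := push_minor_left X r01 hm.
have {}Y1 i q : `|Y i q| <= rho.
  apply: le_trans (Y1 i q) _; rewrite -rr ler_wpM2r ?ler_nat // ltW //.
exists Y; split => // Z hZ; exists g; split => //.
have e : uni Z *m X = uni (Z - Y) *m (uni Y *m X) by rewrite mulmxA -uniD subrK.
have [B1 _] := uni_near X (ltW rho0) Y1.
have hZ' i q : `|(Z - Y) i q| <= eta by rewrite !mxE.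
have [_ /(_ eta1 g)] := uni_near (uni Y *m X) (ltW eta0) hZ'.
rewrite -e -/N => B2.
have M0 := max_minor_ge0 X.
have B3 : eta * 2 ^+ N * max_minor (uni Y *m X) <= c / 2 * max_minor X.
  have -> : c / 2 = eta * (2 ^+ N * 2 ^+ N) by rewrite divfK // gt_eqF.
  rewrite mulrA -[leRHS]mulrA; apply: ler_wpM2l; first by rewrite mulr_ge0 ?exprn_ge0 // ltW.
  apply: le_trans B1 _; rewrite ler_wpM2r // lerXn2r ?nnegrE; lra.
rewrite -ef -/c in Y2.
have := lerB_dist (\det (rowsub g (uni Y *m X))) (\det (rowsub g (uni Z *m X))).
rewrite distrC; lra.
Qed.

Lemma row_full_unit_mul (F : fieldType) (d j : nat) (G : 'M[F]_d) (X : 'M[F]_(d, j)) :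
  G \in unitmx -> row_full (G *m X) = row_full X.
Proof.
by move=> u; rewrite -!col_leq_rank eqmxMfull // row_full_unit.
Qed.

(** By induction on [J], the correction for the new rank is made inside the box that works for the
    previous ranks. *)
Lemma open_push_all (R : realFieldType) (m n : nat) (J : nat) (rho : R) :
  0 < rho <= 1 -> exists c eta : R, [/\ 0 < c, 0 < eta &
  forall X : (forall j, 'M[R]_(m + n, j)),
  exists Y : 'M[R]_(m, n), (forall i q, `|Y i q| <= rho) /\
  forall Z : 'M[R]_(m, n), (forall i q, `|Z i q - Y i q| <= eta) ->
  forall j, (j < J)%N -> row_full (X j) ->
  exists f : {ffun 'I_j -> 'I_(m + n)}, (minn j m <= left_count f)%N /\
    c * max_minor (X j) <= `|\det (rowsub f (uni Z *m X j))|].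
Proof.
elim: J rho => [|J IH] rho rho01.
  exists 1, 1; split => // X; exists 0; split => // i q; rewrite mxE normr0; lra.
have [|c1 [e1 [c10 e10 IHX]]] := IH (rho / 2); first by lra.
set N := #|{: 'I_m * 'I_n}|.
(* Half of [e1] is spent on the second correction, the other half is left for [Z]. *)
pose rho2 := Num.min (e1 / 2) (rho / 2).
have rho20 : 0 < rho2 by rewrite lt_min; apply/andP; split; lra.
have rho2e : rho2 <= e1 / 2 by rewrite ge_min lexx.
have rho2r : rho2 <= rho / 2 by rewrite ge_min lexx orbT.
have [|c2 [e2 [c20 e20 HX]]] := @open_push R m n rho2; first by lra.
have p0 : 0 < 2 ^+ N :> R by rewrite exprn_gt0.
(* The division by [2 ^+ N] pays for comparing [X J] with [uni Y1 *m X J]. *)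
exists (Num.min c1 (c2 / 2 ^+ N)), (Num.min e2 (e1 / 2)); split.
- by rewrite lt_min c10 divr_gt0.
- by rewrite lt_min e20 divr_gt0.
move=> X; have [Y1 [Y1r HY1]] := IHX X.
have full1 : row_full (X J) -> row_full (uni Y1 *m X J).
  by rewrite row_full_unit_mul // unitmxE det_uni unitr1.
have [Y2 [Y2r HY2]] : exists Y : 'M[R]_(m, n), (forall i q, `|Y i q| <= rho2) /\
  (row_full (X J) -> forall Z : 'M[R]_(m, n), (forall i q, `|Z i q - Y i q| <= e2) ->
  exists f : {ffun 'I_J -> 'I_(m + n)}, (minn J m <= left_count f)%N /\
    c2 * max_minor (uni Y1 *m X J) <= `|\det (rowsub f (uni Z *m (uni Y1 *m X J)))|).
  case: (boolP (row_full (X J))) => [/full1/HX[Y [Yr HY]]|_].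
    by exists Y; split => // _.
  by exists 0; split => // i q; rewrite mxE normr0 ltW.
exists (Y1 + Y2); split => [i q|Z hZ j].
  rewrite mxE; apply: le_trans (ler_normD _ _) _.
  have := Y1r i q; have := Y2r i q; lra.
have hZ1 i q : `|Z i q - Y1 i q| <= e1.
  have := hZ i q; rewrite mxE le_min => /andP[_ h].
  have -> : Z i q - Y1 i q = (Z i q - (Y1 i q + Y2 i q)) + Y2 i q by ring.
  apply: le_trans (ler_normD _ _) _; have := Y2r i q; lra.
rewrite ltnS leq_eqVlt => /orP[/eqP jJ|jJ]; last first.
  move=> full; have [f [f1 f2]] := HY1 Z hZ1 j jJ full.
  exists f; split => //; apply: le_trans f2; rewrite ler_wpM2r ?max_minor_ge0 //.
  by rewrite ge_min lexx.
rewrite jJ => full; have hZ2 i q : `|(Z - Y1) i q - Y2 i q| <= e2.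
  have := hZ i q; rewrite !mxE le_min => /andP[h _].
  by have -> : Z i q - Y1 i q - Y2 i q = Z i q - (Y1 i q + Y2 i q) by ring.
have [f [f1]] := HY2 full _ hZ2; rewrite mulmxA -uniD subrK => f2.
exists f; split => //; apply: le_trans f2.
have Y1r' i q : `|(- Y1) i q| <= rho / 2 by rewrite mxE normrN.
have r2 : 0 <= rho / 2 by lra.
have [B _] := uni_near (uni Y1 *m X J) r2 Y1r'.
rewrite mulmxA -uniD addNr uni0 mul1mx -/N in B.
have {}B : max_minor (X J) <= 2 ^+ N * max_minor (uni Y1 *m X J).
  apply: le_trans B _; rewrite ler_wpM2r ?max_minor_ge0 // lerXn2r ?nnegrE; lra.
apply: (@le_trans _ _ (c2 / 2 ^+ N * max_minor (X J))).
  by rewrite ler_wpM2r ?max_minor_ge0 // ge_min lexx orbT.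
by rewrite -mulrA; apply: ler_wpM2l; rewrite ?ler_pdivrMl // ltW.
Qed.

(** * Submodularity *)

(** An entry of a matrix normalized on the rows [f] is itself a minor; this turns bounds on minors
    into bounds on entries. *)
Lemma det_row_replace (R : comNzRingType) (d j : nat) (X : 'M[R]_(d, j))
    (f : {ffun 'I_j -> 'I_d}) (k : 'I_j) (x : 'I_d) :
  rowsub f X = 1%:M -> \det (rowsub (upd f k x) X) = X x k.
Proof.
move=> fX; rewrite (expand_det_row _ k).
have cof b : cofactor (rowsub (upd f k x) X) k b = (\adj (1%:M : 'M[R]_j)) b k.
  rewrite !mxE /cofactor -fX; congr (_ * \det _); apply/matrixP => a c.
  by rewrite !mxE ffunE eq_sym (negPf (neq_lift _ _)).
have adj1 : \adj (1%:M : 'M[R]_j) = 1%:M by rewrite -[LHS]mul1mx mul_mx_adj det1.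
rewrite (bigD1 k) //= big1 => [|b bk]; rewrite cof adj1 !mxE ?ffunE ?eqxx ?mulr1 ?addr0 //.
by rewrite (negPf bk) mulr0.
Qed.

(** After normalization at a largest minor, every entry is a quotient of some minor by that largest
    one. *)
Lemma max_minor_normal_form (R : realFieldType) (d j : nat) (X : 'M[R]_(d, j)) :
  row_full X -> exists (X1 : 'M[R]_(d, j)) (Q : 'M[R]_j) (f : {ffun 'I_j -> 'I_d}),
  [/\ X = X1 *m Q, `|\det Q| = max_minor X, rowsub f X1 = 1%:M
    & forall x k, `|X1 x k| <= 1].
Proof.
rewrite -max_minor_gt0 => /[dup] M0 /max_minor_attained [f ef].
have d0 : \det (rowsub f X) != 0 by rewrite -normr_gt0 -ef.
have u : rowsub f X \in unitmx by rewrite unitmxE unitfE.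
exists (X *m invmx (rowsub f X)), (rowsub f X), f.
have e1 : rowsub f (X *m invmx (rowsub f X)) = 1%:M by rewrite -mul_rowsub_mx mulmxV.
split => // [|x k]; first by rewrite mulmxKV.
rewrite -(det_row_replace k x e1) -mul_rowsub_mx det_mulmx det_inv normrM normfV -ef.
by rewrite ler_pdivrMr // mul1r minor_le.
Qed.

Lemma det_le_fact (R : realFieldType) (j : nat) (A : 'M[R]_j) :
  (forall a b, `|A a b| <= 1) -> `|\det A| <= j`!%:R.
Proof.
move=> A1; apply: le_trans (ler_norm_sum _ _ _) _.
apply: (@le_trans _ _ (\sum_(s : 'S_j) (1 : R))); last by rewrite sumr_const card_Sn.
apply: ler_sum => s _; rewrite normrM normr_sign mul1r normr_prod.
by apply: prodr_ile1 => i _; rewrite normr_ge0 A1.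
Qed.

Lemma max_minor_le_fact (R : realFieldType) (d j : nat) (X : 'M[R]_(d, j)) :
  (forall x k, `|X x k| <= 1) -> max_minor X <= j`!%:R.
Proof.
by move=> X1; apply: max_minor_le => // f; apply: det_le_fact => a b; rewrite !mxE.
Qed.

Lemma row_full_row_mx (F : fieldType) (d p i : nat) (B : 'M[F]_(d, p)) (A : 'M[F]_(d, i)) :
  row_full (row_mx B A) -> row_full B /\ row_full A.
Proof.
move=> /row_fullP[Z]; rewrite -[Z]vsubmxK mul_col_row scalar_mx_block.
by move=> /eq_block_mx[e1 _ _ e2]; split; apply/row_fullP;
  [exists (usubmx Z) | exists (dsubmx Z)].
Qed.

(** The rows [f] complete any minor of [B] to a block triangular minor of [row_mx B A] with an
    identity diagonal block. *)
Lemma max_minor_row_mx (R : realFieldType) (d p i : nat)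
    (B : 'M[R]_(d, p)) (A : 'M[R]_(d, i)) (f : {ffun 'I_i -> 'I_d}) :
  rowsub f A = 1%:M -> rowsub f B = 0 -> max_minor B <= max_minor (row_mx B A).
Proof.
move=> fA fB; apply: max_minor_le => [|g]; first exact: max_minor_ge0.
pose h : {ffun 'I_(p + i) -> 'I_d} :=
  [ffun k => match fintype.split k with inl a => g a | inr b => f b end].
suff -> : \det (rowsub g B) = \det (rowsub h (row_mx B A)) by apply: minor_le.
have -> : rowsub h (row_mx B A) = block_mx (rowsub g B) (rowsub g A) 0 1%:M.
  rewrite -fA -fB; apply/matrixP => a b.
  rewrite -[a]splitK -[b]splitK !mxE !ffunE !unsplitK.
  by case: (fintype.split a) => a' /=; rewrite !mxE unsplitK;
    case: (fintype.split b) => b'; rewrite ?mxE.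
by rewrite det_ublock det1 mulr1.
Qed.

(* Submodularity, up to a constant, of the covolume: it compares the sum
   [C B A] and the intersection [A] of the spans of [B A] and [C A]. *)
Lemma max_minor_submodular (R : realFieldType) (d p q i : nat)
    (C : 'M[R]_(d, q)) (B : 'M[R]_(d, p)) (A : 'M[R]_(d, i)) :
  row_full (row_mx B A) -> row_full (row_mx C A) ->
  max_minor (row_mx C (row_mx B A)) * max_minor A <=
  (q + (p + i))`!%:R * (max_minor (row_mx B A) * max_minor (row_mx C A)).
Proof.
move=> fullBA fullCA.
have fullA : row_full A by case: (row_full_row_mx fullBA).
have [A1 [QA [f [eA dA fA A1le]]]] := max_minor_normal_form fullA.
(* Columns of [A1] are used to clear the rows [f] of [D]. The largest minor of the cleared block,
   [\det Q] up to sign, plays the role of the covolume of [D] modulo [A]. *)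
have red k (D : 'M[R]_(d, k)) : row_full (row_mx D A) ->
    exists (D1 : 'M[R]_(d, k)) (Q : 'M[R]_k) (T : 'M[R]_(i, k)),
    [/\ D = D1 *m Q + A1 *m T, forall x y, `|D1 x y| <= 1 &
        `|\det Q| * `|\det QA| <= max_minor (row_mx D A)].
  move=> full; pose D' := D - A1 *m rowsub f D.
  have eD : row_mx D A = row_mx D' A1 *m block_mx 1%:M 0 (rowsub f D) QA.
    by rewrite mul_row_block mulmx1 mulmx0 add0r -eA subrK.
  have mD : max_minor (row_mx D A) = max_minor (row_mx D' A1) * `|\det QA|.
    by rewrite eD max_minor_mulmx det_lblock det1 mul1r.
  have fD' : rowsub f D' = 0.
    have -> : rowsub f D' = rowsub f D - rowsub f (A1 *m rowsub f D).
      by apply/matrixP => a b; rewrite !mxE.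
    by rewrite -mul_rowsub_mx fA mul1mx subrr.
  have fullD' : row_full D'.
    suff /row_full_row_mx[] : row_full (row_mx D' A1) by [];
    have dA0 : 0 < `|\det QA| by rewrite dA max_minor_gt0.
    by rewrite -max_minor_gt0 -(pmulr_lgt0 _ dA0) -mD max_minor_gt0.
  have [D1 [Q [g [e1 dQ _ D1le]]]] := max_minor_normal_form fullD'.
  exists D1, Q, (rowsub f D); split => //; first by rewrite -e1 subrK.
  by rewrite mD ler_wpM2r // dQ (max_minor_row_mx fA).
have [B1 [QB [TB [eB B1le dB]]]] := red _ _ fullBA.
have [C1 [QC [TC [eC C1le dC]]]] := red _ _ fullCA.
have -> : row_mx C (row_mx B A) = row_mx C1 (row_mx B1 A1) *m
    block_mx QC 0 (col_mx 0 TC) (block_mx QB 0 TB QA).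
  rewrite mul_row_block mulmx0 add0r mul_row_col mulmx0 add0r -eC mul_row_block.
  by rewrite mulmx0 add0r -eB -eA.
rewrite max_minor_mulmx !det_lblock !normrM -dA.
set N := max_minor (row_mx C1 _); have N0 : 0 <= N := max_minor_ge0 _.
(* All entries are at most [1] in absolute value after normalization, so the only loss is the number
   of terms in the Leibniz formula. *)
have NF : N <= (q + (p + i))`!%:R.
  apply: max_minor_le_fact => x k; rewrite mxE; case: splitP => k' _ //.
  by rewrite mxE; case: splitP.
have -> : N * (`|\det QC| * (`|\det QB| * `|\det QA|)) * `|\det QA| =
  N * ((`|\det QB| * `|\det QA|) * (`|\det QC| * `|\det QA|)) by ring.
by rewrite ler_pM // ?mulr_ge0 // ler_pM // mulr_ge0.
Qed.

(** * Sums and intersections of integer lattices *)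

(** Zero divides only zero, and positions beyond the end of [d] read as zero too. *)
Lemma sorted_dvdz_zeros (d : seq int) (k l : nat) :
  sorted dvdz d -> (k <= l)%N -> d`_k = 0 -> d`_l = 0.
Proof.
move=> sd kl dk; have [ls|?] := ltnP l (size d); last by rewrite nth_default.
have := sorted_leq_nth (@dvdz_trans) (@dvdzz) 0 sd; move/(_ k l).
rewrite !inE ls (leq_ltn_trans kl ls) dk dvd0z => h.
by apply/eqP; apply: h.
Qed.

(* The columns of [rsubmx U] span the integer kernel of [N], and the columns
   of [U] form a basis of the whole lattice. *)
Lemma int_kernel_split (R : realFieldType) (e j : nat) (N : 'M[int]_(e, j)) :
  exists (p i : nat) (U : 'M[int]_(j, p + i)) (V : 'M[int]_(p + i, j)),
  [/\ (p + i)%N = j, U *m V = 1%:M, V *m U = 1%:M, N *m rsubmx U = 0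
    & row_full (map_mx intr (N *m lsubmx U) : 'M[R]_(e, p))].
Proof.
have [L uL [S uS [d sd ->]]] := int_Smith_normal_form N.
have [p [i [E dp di]]] : exists p i, [/\ (p + i)%N = j,
    forall k, (k < p)%N -> (k < e)%N /\ d`_k != 0
  & forall k, (p <= k < j)%N -> (k < e)%N -> d`_k = 0].
  (* The length of [d] is unrelated to the dimensions of [N], so the number [p] of nonzero diagonal
     entries is capped by both of them. *)
  pose p := minn j (minn e (find (fun x => x == 0) d)).
  exists p, (j - p)%N; split => [|k|k /andP[pk kj] ke]; first by rewrite subnKC ?geq_minl.
    rewrite !leq_min => /and3P[_ ke kd]; split => //.
    by have := before_find 0 kd => /= ->.
  have dk : (find (fun x : int => x == 0%R) d <= k)%N.
    by move: pk; rewrite /p !geq_min leqNgt kj /= [(e <= k)%N]leqNgt ke.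
  apply: (sorted_dvdz_zeros sd dk).
  have [h|h] := boolP (has (fun x => x == 0) d); first by apply/eqP/(nth_find 0 h).
  by rewrite nth_default // hasNfind.
case: j / E S uS N di => S uS _ di.
exists p, i, (invmx S), S; set D := \matrix_(_, _) _.
rewrite mulVmx // mulmxV //; split => //.
- rewrite mulmx_rsub mulmxK // -mulmx_rsub [rsubmx D](_ : _ = 0) ?mulmx0 //.
  apply/matrixP => a b; rewrite !mxE /=; case: eqP => [h|_]; last by rewrite mulr0n.
  by rewrite mulr1n h di // ?leq_addr ?ltn_add2l ?ltn_ord //= -h ltn_ord.
rewrite mulmx_lsub mulmxK // -mulmx_lsub map_mxM.
apply/row_fullP; exists ((\matrix_(k < p, a < e) ((d`_k)%:~R^-1 *+ (k == a :> nat))) *m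
  map_mx intr (invmx L)).
rewrite -mulmxA [map_mx _ (invmx L) *m _]mulmxA -map_mxM mulVmx // map_mx1 mul1mx.
apply/matrixP => k l; rewrite !mxE; have [ke dk] := dp k (ltn_ord k).
rewrite (bigD1 (Ordinal ke)) //= big1 => [|a ak]; last first.
  rewrite !mxE [_ == _ :> nat]eq_sym (_ : (a == k :> nat) = false) ?mulr0n ?mul0r //.
  by apply: contraNF ak => /eqP e1; apply/eqP/val_inj; exact: e1.
rewrite !mxE /= eqxx addr0 mulr1n; have [<-|kl] := eqVneq k l.
  by rewrite eqxx mulr1n mulVf // intr_eq0.
by rewrite (negPf kl : (k == l :> nat) = false) mulr0n mulr0.
Qed.

(** The rows of [K] form a basis of the integer relations killing the columns of [X], obtained as
    the integer kernel of [X^T]; they cut out exactly the real span of [X]. *)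
Lemma int_cokernel (R : realFieldType) (d j : nat) (X : 'M[int]_(d, j)) :
  exists (e : nat) (K : 'M[int]_(e, d)), K *m X = 0 /\
  forall q (y : 'M[R]_(d, q)), map_mx intr K *m y = 0 ->
  exists z, y = map_mx intr X *m z.
Proof.
have [p [i [U [V [_ UV VU NU /row_fullP[W eW]]]]]] := int_kernel_split R X^T.
exists i, (rsubmx U)^T; split=> [|q y Ky].
  by apply: trmx_inj; rewrite trmx_mul trmxK NU trmx0.
have decomp q' (x : 'M[R]_(d, q')) : map_mx intr (rsubmx U)^T *m x = 0 ->
    x = map_mx intr (usubmx V)^T *m (map_mx intr (lsubmx U)^T *m x).
  move=> Kx; rewrite -[LHS]mul1mx -(@map_mx1 _ _ (intr : int -> R)) -trmx1 -UV trmx_mul.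
  rewrite -[in V^T](vsubmxK V) tr_col_mx -[in U^T](hsubmxK U) tr_row_mx mul_row_col.
  by rewrite map_mxD !map_mxM mulmxDl -!mulmxA Kx mulmx0 addr0.
have eX : map_mx intr X = map_mx intr (usubmx V)^T *m
    map_mx intr (X^T *m lsubmx U)^T :> 'M[R]_(d, j).
  rewrite trmx_mul trmxK map_mxM; apply: decomp.
  by rewrite -map_mxM -[X]trmxK -trmx_mul NU trmx0 map_mx0.
exists (W^T *m (map_mx intr (lsubmx U)^T *m y)); rewrite eX [LHS](decomp _ _ Ky) -!mulmxA.
by rewrite [map_mx _ _ *m (W^T *m _)]mulmxA
  -[map_mx _ (_ *m _)^T]map_trmx -trmx_mul eW trmx1 mul1mx.
Qed.

Lemma int_unimodular_norm_det (R : realFieldType) (j : nat) (U V : 'M[int]_j) :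
  U *m V = 1%:M -> `|\det (map_mx intr U : 'M[R]_j)| = 1.
Proof.
move=> UV; have := congr1 (fun M => absz (\det M)) UV.
rewrite det_mulmx det1 abszM => /eqP; rewrite muln_eq1 => /andP[/eqP h _].
by rewrite det_map_mx -intr_norm -abszE h.
Qed.

Lemma max_minor_unimodular (R : realFieldType) (d j k : nat) (X : 'M[R]_(d, j))
    (U : 'M[int]_(j, k)) (V : 'M[int]_(k, j)) :
  k = j -> U *m V = 1%:M -> max_minor (X *m map_mx intr U) = max_minor X.
Proof.
move=> e; case: j / e X U V => X U V UV.
by rewrite max_minor_mulmx (int_unimodular_norm_det R UV) mulr1.
Qed.

(** [A] generates the part of the column lattice of [X] killed by [K], and [B] completes it to a
    basis. The change of basis is unimodular, which preserves covolumes under every [G]. *)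
Lemma lattice_split (R : realFieldType) (d j e : nat) (X : 'M[int]_(d, j))
    (K : 'M[int]_(e, d)) :
  row_full (map_mx intr X : 'M[R]_(d, j)) ->
  exists (p i : nat) (B : 'M[int]_(d, p)) (A : 'M[int]_(d, i)) (V : 'M[int]_(p + i, j)),
  [/\ (p + i)%N = j, X = row_mx B A *m V,
      forall G : 'M[R]_d, max_minor (G *m map_mx intr (row_mx B A)) =
                          max_minor (G *m map_mx intr X) &
  [/\ K *m A = 0, row_full (map_mx intr (K *m B) : 'M[R]_(e, p)),
      row_full (map_mx intr (row_mx B A) : 'M[R]_(d, p + i)) &
      exists S, row_mx B A = X *m S]].
Proof.
move=> fullX; have [p [i [U [V [E UV VU NU full]]]]] := int_kernel_split R (K *m X).
have eU : row_mx (X *m lsubmx U) (X *m rsubmx U) = X *m U.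
  by rewrite -mul_mx_row hsubmxK.
have eG (G : 'M[R]_d) : max_minor (G *m map_mx intr (X *m U)) =
    max_minor (G *m map_mx intr X).
  by rewrite map_mxM mulmxA (max_minor_unimodular _ E UV).
exists p, i, (X *m lsubmx U), (X *m rsubmx U), V; rewrite eU; split => //.
  by rewrite -mulmxA UV mulmx1.
split; rewrite ?mulmxA //; last by exists U.
by have := eG 1%:M; rewrite !mul1mx -!max_minor_gt0 => ->; rewrite max_minor_gt0.
Qed.

(** Both [y] and its component along [A] are killed by [K], while [K] is injective on the span of
    [B], so the component along [B] vanishes. *)
Lemma split_factor (R : realFieldType) (d j e p i q : nat) (X : 'M[int]_(d, j))
    (K : 'M[int]_(e, d)) (B : 'M[int]_(d, p)) (A : 'M[int]_(d, i))
    (V : 'M[int]_(p + i, j)) (y : 'M[R]_(d, q)) :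
  X = row_mx B A *m V -> K *m A = 0 -> row_full (map_mx intr (K *m B) : 'M[R]_(e, p)) ->
  map_mx intr K *m y = 0 -> (exists z, y = map_mx intr X *m z) ->
  exists w, y = map_mx intr A *m w.
Proof.
move=> eX KA full Ky [z ez].
rewrite eX map_mxM -mulmxA in ez; set v := map_mx intr V *m z in ez.
rewrite map_row_mx -[v]vsubmxK mul_row_col in ez.
have /(row_full_inj full) u0 : map_mx intr (K *m B) *m usubmx v = map_mx intr (K *m B) *m 0.
  move: Ky; rewrite ez mulmxDr !mulmxA -!map_mxM KA map_mx0 mul0mx addr0 => ->.
  by rewrite mulmx0.
by exists (dsubmx v); rewrite {1}ez u0 mulmx0 add0r.
Qed.

(** [A] and [A'] generate the intersection of each lattice with the real span of the other. They
    span the same real space but may generate different groups, whence the matrices [w] and [w'].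
    The sum of the two subgroups is represented by [row_mx C (row_mx B A)]. *)
Lemma lattice_pair (R : realFieldType) (d j : nat) (X X' : 'M[int]_(d, j)) :
  row_full (map_mx intr X : 'M[R]_(d, j)) ->
  row_full (map_mx intr X' : 'M[R]_(d, j)) ->
  ~ (exists z : 'M[R]_j, map_mx intr X' = map_mx intr X *m z) ->
  exists (p i : nat) (B C : 'M[int]_(d, p)) (A A' : 'M[int]_(d, i)) (w w' : 'M[R]_i),
  [/\ (0 < p)%N, (p + i)%N = j,
      forall G : 'M[R]_d, max_minor (G *m map_mx intr (row_mx B A)) =
                          max_minor (G *m map_mx intr X),
      forall G : 'M[R]_d, max_minor (G *m map_mx intr (row_mx C A')) =
                          max_minor (G *m map_mx intr X') &
  [/\ map_mx intr A' = map_mx intr A *m w, map_mx intr A = map_mx intr A' *m w' &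
      row_full (map_mx intr (row_mx C (row_mx B A)) : 'M[R]_(d, p + (p + i)))]].
Proof.
move=> full full' ne.
have [e [K' [K'X K'P]]] := int_cokernel R X.
have [e' [K [KX' KP]]] := int_cokernel R X'.
have [p [i [B [A [V [E eX eG [KA KB BA [S0 eS0]]]]]]]] := lattice_split K full.
have [p' [i' [C [A' [V' [E' eX' eG' [KA' KC CA [S0' eS0']]]]]]]] := lattice_split K' full'.
have eS : A = X *m rsubmx S0 by rewrite mulmx_rsub -eS0 row_mxKr.
have eS' : A' = X' *m rsubmx S0' by rewrite mulmx_rsub -eS0' row_mxKr.
have [w ew] : exists w, map_mx intr A' = map_mx intr A *m w :> 'M[R]_(d, i').
  apply: (split_factor eX KA KB); first by rewrite -map_mxM eS' mulmxA KX' mul0mx map_mx0.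
  by apply: K'P; rewrite -map_mxM KA' map_mx0.
have [w' ew'] : exists w, map_mx intr A = map_mx intr A' *m w :> 'M[R]_(d, i).
  apply: (split_factor eX' KA' KC); first by rewrite -map_mxM eS mulmxA K'X mul0mx map_mx0.
  by apply: KP; rewrite -map_mxM KA map_mx0.
have ei : i = i'.
  have rA : \rank (map_mx intr A : 'M[R]_(d, i)) = i.
    by apply/eqP; move: BA; rewrite map_row_mx => /row_full_row_mx[].
  have rA' : \rank (map_mx intr A' : 'M[R]_(d, i')) = i'.
    by apply/eqP; move: CA; rewrite map_row_mx => /row_full_row_mx[].
  have l1 := mxrankM_maxl (map_mx intr A' : 'M[R]_(d, i')) w'.
  have l2 := mxrankM_maxl (map_mx intr A : 'M[R]_(d, i)) w.
  by apply/eqP; rewrite eqn_leq; rewrite -ew -ew' rA rA' in l1 l2; rewrite l1 l2.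
subst i'.
have ep : p = p' by apply/eqP; rewrite -(eqn_add2r i) E E'.
subst p'.
exists p, i, B, C, A, A', w, w'; split => //.
  (* With [p = 0], the columns of [X'] would lie in the span of [A'], hence in that of [X]. *)
  rewrite lt0n; apply/eqP => p0; apply: ne.
  have C0 : map_mx intr C = 0 :> 'M[R]_(d, p).
    by apply/matrixP => a b; have := leq_trans (ltn_ord b) (eq_leq p0).
  exists (map_mx intr (rsubmx S0) *m w *m dsubmx (map_mx intr V')).
  rewrite eX' map_mxM map_row_mx C0 -[map_mx intr V' in LHS]vsubmxK mul_row_col mul0mx add0r.
  by rewrite ew !mulmxA -map_mxM -eS.
split => //.
have /row_fullP[Z eZ] := BA; have /row_fullP[L eL] := KC.
have K'BA : K' *m row_mx B A = 0 by rewrite eS0 mulmxA K'X mul0mx.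
rewrite map_row_mx; set M := row_mx _ _.
(* [K'] kills the span of [X] and is injective on the span of [C], so this left factor produces a
   unitriangular block matrix. *)
have eM : col_mx (L *m map_mx intr K') Z *m M = block_mx 1%:M 0 (Z *m map_mx intr C) 1%:M.
  by rewrite mul_col_row -!mulmxA -!map_mxM K'BA map_mx0 mulmx0 eL eZ.
have u : block_mx 1%:M 0 (Z *m map_mx intr C) 1%:M \in unitmx.
  by rewrite unitmxE det_lblock !det1 mulr1 unitr1.
apply/row_fullP; exists (invmx (block_mx 1%:M 0 (Z *m map_mx intr C) 1%:M) *m
  col_mx (L *m map_mx intr K') Z).
by rewrite -mulmxA eM mulVmx.
Qed.

(** * The diagonal flow *)

Definition flow_weight (R : realType) (m n : nat) (r : 'I_m -> R) (s : 'I_n -> R)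
    (x : 'I_(m + n)) : R :=
  match fintype.split x with inl i => r i | inr q => - s q end.

Definition flow_mx (R : realType) (m n : nat) (r : 'I_m -> R) (s : 'I_n -> R)
    (t : R) : 'M[R]_(m + n) :=
  diag_mx (\row_x expR (flow_weight r s x * t)).

(* The unimodular lattice [lattice_mx r s t Y *m Z^(m+n)] is the point at time
   [t] of the diagonal trajectory associated with [Y]. *)
Definition lattice_mx (R : realType) (m n : nat) (r : 'I_m -> R) (s : 'I_n -> R)
    (t : R) (Y : 'M[R]_(m, n)) : 'M[R]_(m + n) := flow_mx r s t *m uni Y.

Lemma flow_weight_lshift (R : realType) (m n : nat) (r : 'I_m -> R) (s : 'I_n -> R) i :
  flow_weight r s (lshift n i) = r i.
Proof. by rewrite /flow_weight -/(unsplit (inl i)) unsplitK. Qed.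

Lemma flow_weight_rshift (R : realType) (m n : nat) (r : 'I_m -> R) (s : 'I_n -> R) q :
  flow_weight r s (rshift m q) = - s q.
Proof. by rewrite /flow_weight -/(unsplit (inr q)) unsplitK. Qed.

Lemma flow_mxE (R : realType) (m n j : nat) (r : 'I_m -> R) (s : 'I_n -> R)
    (t : R) (X : 'M[R]_(m + n, j)) x k :
  (flow_mx r s t *m X) x k = expR (flow_weight r s x * t) * X x k.
Proof. by rewrite mul_diag_mx !mxE. Qed.

Lemma mulmx_flowE (R : realType) (m n j : nat) (r : 'I_m -> R) (s : 'I_n -> R)
    (t : R) (X : 'M[R]_(j, m + n)) k x :
  (X *m flow_mx r s t) k x = X k x * expR (flow_weight r s x * t).
Proof. by rewrite mul_mx_diag !mxE. Qed.

Lemma flow_mxD (R : realType) (m n : nat) (r : 'I_m -> R) (s : 'I_n -> R) (t u : R) :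
  flow_mx r s (t + u) = flow_mx r s u *m flow_mx r s t.
Proof.
rewrite mulmx_diag; congr diag_mx; apply/rowP => x; rewrite !mxE -expRD.
by congr expR; ring.
Qed.

(** Conjugation by the flow multiplies the entry [(i, j)] of the upper right block by
    [expR ((r i + s j) * t)], which undoes [weight_flow]. *)
Lemma flow_mx_uni (R : realType) (m n : nat) (r : 'I_m -> R) (s : 'I_n -> R)
    (t : R) (Y : 'M[R]_(m, n)) :
  flow_mx r s t *m uni (weight_flow r s t Y) = uni Y *m flow_mx r s t.
Proof.
apply/matrixP => x y; rewrite flow_mxE mulmx_flowE.
rewrite -[x]splitK -[y]splitK.
case: (fintype.split x) => a; case: (fintype.split y) => b /=;
  rewrite /uni ?block_mxEul ?block_mxEur ?block_mxEdl ?block_mxEdr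
    ?flow_weight_lshift ?flow_weight_rshift ?mxE ?mulr0 ?mul0r //.
- by case: eqVneq => [->|_]; rewrite ?mulr1 ?mul1r // mulr0 mul0r.
- by rewrite mulrA -expRD mulrC; congr (_ * expR _); ring.
- by case: eqVneq => [->|_]; rewrite ?mulr1 ?mul1r // mulr0 mul0r.
Qed.

Lemma lattice_mx_step (R : realType) (m n : nat) (r : 'I_m -> R) (s : 'I_n -> R)
    (t T : R) (h y : 'M[R]_(m, n)) :
  lattice_mx r s (t + T) (h + weight_flow r s t y) =
  flow_mx r s T *m (uni y *m lattice_mx r s t h).
Proof.
by rewrite /lattice_mx flow_mxD addrC uniD !mulmxA -(mulmxA _ _ (uni (weight_flow _ _ _ _)))
  flow_mx_uni !mulmxA.
Qed.

Lemma det_rowsub_flow (R : realType) (m n j : nat) (r : 'I_m -> R) (s : 'I_n -> R)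
    (t : R) (X : 'M[R]_(m + n, j)) (f : 'I_j -> 'I_(m + n)) :
  \det (rowsub f (flow_mx r s t *m X)) =
  expR ((\sum_k flow_weight r s (f k)) * t) * \det (rowsub f X).
Proof.
have -> : rowsub f (flow_mx r s t *m X) =
    diag_mx (\row_k expR (flow_weight r s (f k) * t)) *m rowsub f X.
  by apply/matrixP => a b; rewrite !mul_diag_mx !mxE.
rewrite det_mulmx det_diag mulr_suml expR_sum; congr (_ * _).
by apply: eq_bigr => k _; rewrite mxE.
Qed.

Lemma sum_flow_weight (R : realType) (m n : nat) (r : 'I_m -> R) (s : 'I_n -> R) :
  \sum_i r i = 1 -> \sum_q s q = 1 -> \sum_x flow_weight r s x = 0.
Proof.
move=> r1 s1; rewrite big_split_ord /=.
rewrite (eq_bigr r) => [|i _]; last by rewrite flow_weight_lshift.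
rewrite [X in _ + X](eq_bigr (fun q => - s q)) => [|q _]; last by rewrite flow_weight_rshift.
by rewrite sumrN r1 s1 subrr.
Qed.

Lemma det_lattice_mx (R : realType) (m n : nat) (r : 'I_m -> R) (s : 'I_n -> R)
    (t : R) (Y : 'M[R]_(m, n)) :
  \sum_i r i = 1 -> \sum_q s q = 1 -> \det (lattice_mx r s t Y) = 1.
Proof.
move=> r1 s1; rewrite det_mulmx det_uni mulr1 det_diag.
under eq_bigr do rewrite mxE.
by rewrite -expR_sum -mulr_suml sum_flow_weight // mul0r expR0.
Qed.

Lemma flow_weight_le1 (R : realType) (m n : nat) (r : 'I_m -> R) (s : 'I_n -> R) x :
  (forall i, 0 < r i) -> (forall q, 0 < s q) ->
  \sum_i r i = 1 -> \sum_q s q = 1 -> `|flow_weight r s x| <= 1.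
Proof.
move=> r0 s0 r1 s1; rewrite -[x]splitK; case: (fintype.split x) => a /=.
  rewrite flow_weight_lshift gtr0_norm // -r1 (bigD1 a) //= lerDl.
  by apply: sumr_ge0 => i _; apply: ltW.
rewrite flow_weight_rshift normrN gtr0_norm // -s1 (bigD1 a) //= lerDl.
by apply: sumr_ge0 => i _; apply: ltW.
Qed.

(** The flow scales each minor by the exponential of [t] times a sum of [j] weights, all in
    [[-1, 1]]. *)
Lemma max_minor_flow_ge (R : realType) (m n j : nat) (r : 'I_m -> R) (s : 'I_n -> R)
    (t : R) (X : 'M[R]_(m + n, j)) :
  (forall i, 0 < r i) -> (forall q, 0 < s q) ->
  \sum_i r i = 1 -> \sum_q s q = 1 ->
  expR (- (j%:R * `|t|)) * max_minor X <= max_minor (flow_mx r s t *m X).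
Proof.
move=> r0 s0 r1 s1; rewrite mulrC -ler_pdivlMr ?expR_gt0 // -expRN opprK.
apply: max_minor_le => [|f]; first by rewrite mulr_ge0 ?max_minor_ge0 ?expR_ge0.
apply: (@le_trans _ _ (expR (j%:R * `|t|) * `|\det (rowsub f (flow_mx r s t *m X))|));
  last first.
  by rewrite mulrC ler_wpM2r ?expR_ge0 // minor_le.
rewrite det_rowsub_flow normrM gtr0_norm ?expR_gt0 // mulrA -expRD ler_peMl //.
apply: le_trans (expR_ge1Dx _); rewrite lerDl -lerBlDr sub0r; apply: le_trans (ler_norm _) _.
rewrite normrN normrM ler_wpM2r //; apply: le_trans (ler_norm_sum _ _ _) _.
have <- : \sum_(k < j) (1 : R) = j%:R by rewrite sumr_const card_ord.
by apply: ler_sum => k _; apply: flow_weight_le1.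
Qed.

(* A minor using as many of the first [m] rows as possible is expanded: its
   weight is either a nonempty sum of [r i]'s, or the sum of the [s q] over the
   rows it does not use. *)
Lemma left_minor_weight (R : realType) (m n j : nat) (r : 'I_m -> R) (s : 'I_n -> R)
    (lambda : R) (f : 'I_j -> 'I_(m + n)) :
  (forall i, 0 < r i) -> (forall q, 0 < s q) ->
  \sum_i r i = 1 -> \sum_q s q = 1 ->
  (forall i, lambda <= r i) -> (forall q, lambda <= s q) ->
  (0 < j < m + n)%N -> injective f -> (minn j m <= left_count f)%N ->
  lambda <= \sum_k flow_weight r s (f k).
Proof.
move=> r0 s0 r1 s1 lr ls /andP[j0 jd] finj hf.
have [jm|mj] := leqP j m.
  have fl k : (f k < m)%N.
    have : [set k | (f k < m)%N] = [set: 'I_j].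
      apply/eqP; rewrite eqEcard finset.subsetT cardsT card_ord /=.
      by move: hf; rewrite (minn_idPl jm).
    by move=> /finset.setP/(_ k); rewrite !inE.
  have wge k : lambda <= flow_weight r s (f k) /\ 0 <= flow_weight r s (f k).
    have := fl k; case: (split_ordP (f k)) => // i -> _.
    by rewrite flow_weight_lshift; split; [exact: lr | exact: ltW].
  rewrite (bigD1 (Ordinal j0)) //= -[lambda]addr0 lerD //; first by case: (wge (Ordinal j0)).
  by apply: sumr_ge0 => k _; case: (wge k).
have fleft i : lshift n i \in f @: [set: 'I_j].
  have cl : #|f @: [set k | (f k < m)%N]| = left_count f by rewrite card_imset.
  have sub : f @: [set k | (f k < m)%N] \subset lshift n @: [set: 'I_m].
    apply/fintype.subsetP => x /imsetP[k]; rewrite inE => hk ->.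
    by move: hk; case: (split_ordP (f k)) => // i' -> _; apply: imset_f.
  have /eqP e : f @: [set k | (f k < m)%N] == lshift n @: [set: 'I_m].
    rewrite eqEcard sub cl (card_imset _ (@lshift_inj m n)) cardsT card_ord.
    by move: hf; rewrite (minn_idPr (ltnW mj)).
  have : lshift n i \in f @: [set k | (f k < m)%N] by rewrite e imset_f.
  by move=> /imsetP[k _ ->]; apply: imset_f.
have -> : \sum_k flow_weight r s (f k) = \sum_(x in f @: [set: 'I_j]) flow_weight r s x.
  rewrite big_imset /=; last by move=> ? ? _ _; apply: finj.
  by apply: eq_bigl => k; rewrite inE.
have [x xf] : exists x, x \notin f @: [set: 'I_j].
  case: (pickP (fun x => x \notin f @: [set: 'I_j])) => [x|no]; first by exists x.
  suff : (m + n <= j)%N by rewrite leqNgt jd.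
  rewrite -[leqRHS]card_ord -[leqRHS]cardsT -(card_imset _ finj) -[leqLHS]card_ord.
  by apply/subset_leq_card/fintype.subsetP => x _; have /negbFE := no x.
have eS : \sum_(x in f @: [set: 'I_j]) flow_weight r s x =
    - \sum_(x in ~: (f @: [set: 'I_j])) flow_weight r s x.
  have := sum_flow_weight r1 s1; rewrite (bigID [in f @: [set: 'I_j]]) /= => /eqP.
  by rewrite addr_eq0 => /eqP ->; congr (- _); apply: eq_bigl => y; rewrite inE.
have wge y : y \notin f @: [set: 'I_j] ->
    lambda <= - flow_weight r s y /\ 0 <= - flow_weight r s y.
  case: (split_ordP y) => [i ->|q ->]; first by rewrite fleft.
  by rewrite flow_weight_rshift opprK; split; [exact: ls | exact: ltW].
rewrite eS -sumrN (bigD1 x) /= ?inE // -[lambda]addr0 lerD //; first by case: (wge x xf).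
by apply: sumr_ge0 => y; rewrite inE => /andP[/wge[]].
Qed.

(** * One round of the game *)

Definition rank_weight (R : realType) (d j : nat) : R := j%:R * (d%:R - j%:R).

(* The strictly concave profile [rank_weight] forces any two subgroups of
   equal rank that are close to violating the bound to be commensurable. *)
Definition lattice_bounded (R : realType) (m n : nat) (r : 'I_m -> R) (s : 'I_n -> R)
    (M t : R) (Y : 'M[R]_(m, n)) : Prop :=
  forall (j : nat) (X : 'M[int]_(m + n, j)), (0 < j < m + n)%N ->
  row_full (map_mx intr X : 'M[R]_(m + n, j)) ->
  expR (- (M * rank_weight R (m + n) j)) <=
    max_minor (lattice_mx r s t Y *m map_mx intr X).

Lemma row_full_le (F : fieldType) (d j : nat) (X : 'M[F]_(d, j)) :
  row_full X -> (j <= d)%N.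
Proof. by move=> /eqP <-; apply: rank_leq_row. Qed.

Lemma max_minor_int_ge1 (R : realFieldType) (d j : nat) (X : 'M[int]_(d, j)) :
  row_full (map_mx intr X : 'M[R]_(d, j)) ->
  1 <= max_minor (map_mx intr X : 'M[R]_(d, j)).
Proof.
rewrite -max_minor_gt0 => /[dup] M0 /max_minor_attained [f ef]; move: M0; rewrite ef.
have -> : rowsub f (map_mx intr X) = map_mx intr (rowsub f X) :> 'M[R]_j.
  by apply/matrixP => a b; rewrite !mxE.
by rewrite det_map_mx -intr_norm ltr0z ler1z gtz0_ge1.
Qed.

(** Intersections of rank [0] and sums of rank [m + n] occur in the submodularity argument. There
    [rank_weight] vanishes and the covolume is at least [1]: it is an empty minor, respectively the
    absolute determinant of a nonsingular integer matrix. *)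
Lemma lattice_bounded_ext (R : realType) (m n : nat) (r : 'I_m -> R) (s : 'I_n -> R)
    (M t : R) (Y : 'M[R]_(m, n)) (j : nat) (X : 'M[int]_(m + n, j)) :
  \sum_i r i = 1 -> \sum_q s q = 1 ->
  lattice_bounded r s M t Y -> row_full (map_mx intr X : 'M[R]_(m + n, j)) ->
  expR (- (M * rank_weight R (m + n) j)) <=
    max_minor (lattice_mx r s t Y *m map_mx intr X).
Proof.
move=> r1 s1 bdd full; have jd := row_full_le full.
have [j0|j0] := posnP j.
  subst j; rewrite /rank_weight mul0r mulr0 oppr0 expR0.
  case: (pickP (fun f : {ffun 'I_0 -> 'I_(m + n)} => true)) => [f _|no].
    by have := minor_le (lattice_mx r s t Y *m map_mx intr X) f; rewrite det_mx00 normr1.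
  by have := no [ffun k : 'I_0 => match notF (ltn_ord k) with end].
move: jd; rewrite leq_eqVlt => /orP[/eqP jd|jd]; last by apply: bdd; rewrite // j0.
subst j; rewrite /rank_weight subrr !mulr0 oppr0 expR0.
have := minor_le (lattice_mx r s t Y *m map_mx intr X) [ffun k => k].
have -> : rowsub [ffun k => k] (lattice_mx r s t Y *m map_mx intr X) =
    lattice_mx r s t Y *m map_mx intr X.
  by apply/matrixP => a b; rewrite !mxE ffunE.
apply: le_trans; rewrite det_mulmx det_lattice_mx // mul1r det_map_mx -intr_norm.
rewrite ler1z -gtz0_ge1 normr_gt0.
by move: full; rewrite row_full_unit unitmxE det_map_mx unitfE intr_eq0.
Qed.

(** The sum and the intersection have ranks [2 p + i] and [i], whose [rank_weight]s add up to
    [2 p ^ 2] less than twice that of [p + i]. The gain, at least [expR (2 * M)], exceeds the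
    constants of submodularity. *)
Lemma submodular_gap (R : realType) (m n : nat) (r : 'I_m -> R) (s : 'I_n -> R)
    (M t E : R) (Y : 'M[R]_(m, n)) (p i : nat)
    (B C : 'M[int]_(m + n, p)) (A : 'M[int]_(m + n, i)) :
  \sum_i r i = 1 -> \sum_q s q = 1 ->
  lattice_bounded r s M t Y -> 0 <= M -> 0 <= E ->
  ((2 * (m + n))`!)%:R * E ^+ 2 < expR (2 * M) ->
  (0 < p)%N -> (p + i < m + n)%N ->
  row_full (map_mx intr (row_mx C (row_mx B A)) : 'M[R]_(m + n, p + (p + i))) ->
  row_full (map_mx intr (row_mx C A) : 'M[R]_(m + n, p + i)) ->
  let eps := E * expR (- (M * rank_weight R (m + n) (p + i))) in
  max_minor (lattice_mx r s t Y *m map_mx intr (row_mx B A)) <= eps ->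
  max_minor (lattice_mx r s t Y *m map_mx intr (row_mx C A)) <= eps -> False.
Proof.
move=> r1 s1 bdd M0 E0 hE p0 jd fullCBA fullCA eps hB hC.
have [_ fullBA] : row_full (map_mx intr C : 'M[R]_(m + n, p)) /\
    row_full (map_mx intr (row_mx B A) : 'M[R]_(m + n, p + i)).
  by apply: row_full_row_mx; rewrite -map_row_mx.
have [_ fullA] : row_full (map_mx intr B : 'M[R]_(m + n, p)) /\
    row_full (map_mx intr A : 'M[R]_(m + n, i)).
  by apply: row_full_row_mx; rewrite -map_row_mx.
set G := lattice_mx r s t Y in hB hC.
have uG : G \in unitmx by rewrite unitmxE det_lattice_mx // unitr1.
have h1 := lattice_bounded_ext r1 s1 bdd fullCBA.
have h2 := lattice_bounded_ext r1 s1 bdd fullA.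
rewrite -/G in h1 h2.
have sub : max_minor (G *m map_mx intr (row_mx C (row_mx B A))) *
    max_minor (G *m map_mx intr A) <= (p + (p + i))`!%:R * (eps * eps).
  have full1 := fullBA; have full2 := fullCA.
  rewrite -(row_full_unit_mul _ uG) map_row_mx mul_mx_row in full1.
  rewrite -(row_full_unit_mul _ uG) map_row_mx mul_mx_row in full2.
  have := max_minor_submodular full1 full2.
  rewrite -!mul_mx_row -!map_row_mx => /le_trans; apply.
  by rewrite ler_wpM2l // ler_pM // max_minor_ge0.
have {sub h1 h2} := le_trans (ler_pM (expR_ge0 _) (expR_ge0 _) h1 h2) sub.
apply/negP; rewrite -ltNge.
have fct : (p + (p + i))`!%:R <= ((2 * (m + n))`!)%:R :> R.
  by rewrite ler_nat leq_fact //; lia.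
rewrite /eps; set w := rank_weight R (m + n) (p + i).
have -> : (p + (p + i))`!%:R * (E * expR (- (M * w)) * (E * expR (- (M * w)))) =
  (p + (p + i))`!%:R * E ^+ 2 * expR (- (M * w) - (M * w)) by rewrite expRD; ring.
apply: (@lt_le_trans _ _ (expR (2 * M) * expR (- (M * w) - (M * w)))).
  rewrite ltr_pM2r ?expR_gt0 //; apply: le_lt_trans hE.
  by rewrite ler_wpM2r // exprn_ge0.
rewrite -!expRD ler_expR /w /rank_weight !natrD.
have p1 : 1 <= p%:R :> R by rewrite ler1n.
have : 2 * M <= 2 * M * p%:R ^+ 2 by rewrite ler_peMr ?mulr_ge0 // exprn_ege1.
rewrite expr2; lra.
Qed.

Lemma short_subgroups_commensurable (R : realType) (m n : nat)
    (r : 'I_m -> R) (s : 'I_n -> R) (M t E : R) (Y : 'M[R]_(m, n)) (j : nat)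
    (X X' : 'M[int]_(m + n, j)) :
  \sum_i r i = 1 -> \sum_q s q = 1 ->
  lattice_bounded r s M t Y -> 0 <= M -> 0 <= E ->
  ((2 * (m + n))`!)%:R * E ^+ 2 < expR (2 * M) -> (j < m + n)%N ->
  row_full (map_mx intr X : 'M[R]_(m + n, j)) ->
  row_full (map_mx intr X' : 'M[R]_(m + n, j)) ->
  let eps := E * expR (- (M * rank_weight R (m + n) j)) in
  max_minor (lattice_mx r s t Y *m map_mx intr X) <= eps ->
  max_minor (lattice_mx r s t Y *m map_mx intr X') <= eps ->
  exists z : 'M[R]_j, map_mx intr X' = map_mx intr X *m z.
Proof.
move=> r1 s1 bdd M0 E0 hE jd full full' eps hX hX'.
case: (pselect (exists z : 'M[R]_j, map_mx intr X' = map_mx intr X *m z)) => // ne.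
have [p [i [B [C [A [A' [w [w' [p0 E1 eG eG' [ew ew' fullCBA]]]]]]]]]] :=
  lattice_pair full full' ne.
exfalso; case: j / E1 X X' jd full full' @eps hX hX' {ne} eG eG' =>
  X X' jd full full' eps hX hX' eG eG'.
set G := lattice_mx r s t Y in hX hX' *.
have uG : G \in unitmx by rewrite unitmxE det_lattice_mx // unitr1.
have eCA : map_mx intr (row_mx C A') =
    map_mx intr (row_mx C A) *m block_mx 1%:M 0 0 w :> 'M[R]_(m + n, p + i).
  by rewrite !map_row_mx mul_row_block mulmx1 !mulmx0 addr0 add0r -ew.
have eBA : map_mx intr (row_mx B A') =
    map_mx intr (row_mx B A) *m block_mx 1%:M 0 0 w :> 'M[R]_(m + n, p + i).
  by rewrite !map_row_mx mul_row_block mulmx1 !mulmx0 addr0 add0r -ew.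
have eCBA : map_mx intr (row_mx C (row_mx B A')) =
    map_mx intr (row_mx C (row_mx B A)) *m block_mx 1%:M 0 0 (block_mx 1%:M 0 0 w)
    :> 'M[R]_(m + n, p + (p + i)).
  rewrite map_row_mx eBA [in RHS]map_row_mx mul_row_block.
  by rewrite mulmx1 !mulmx0 addr0 add0r.
have mCA (H : 'M[R]_(m + n)) : max_minor (H *m map_mx intr (row_mx C A')) =
    max_minor (H *m map_mx intr (row_mx C A)) * `|\det w|.
  by rewrite eCA mulmxA max_minor_mulmx det_ublock det1 mul1r.
have mBA (H : 'M[R]_(m + n)) : max_minor (H *m map_mx intr (row_mx B A')) =
    max_minor (H *m map_mx intr (row_mx B A)) * `|\det w|.
  by rewrite eBA mulmxA max_minor_mulmx det_ublock det1 mul1r.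
have fullCA' : row_full (map_mx intr (row_mx C A') : 'M[R]_(m + n, p + i)).
  by rewrite -max_minor_gt0 -[map_mx _ _]mul1mx eG' mul1mx max_minor_gt0.
have dw : 0 < `|\det w|.
  rewrite lt_def normr_ge0 andbT; apply/eqP => dw0.
  move: fullCA'; rewrite -max_minor_gt0 -[map_mx _ _]mul1mx mCA.
  by rewrite dw0 mulr0 ltxx.
have fullCA : row_full (map_mx intr (row_mx C A) : 'M[R]_(m + n, p + i)).
  rewrite -max_minor_gt0 -(pmulr_lgt0 _ dw) -[map_mx _ _]mul1mx -mCA mul1mx.
  by rewrite max_minor_gt0.
(* Both subgroups need the same intersection. It is taken to be [A] or [A'] according to [w], so
   that the replacement does not increase the covolume. *)
have [w1|w1] := lerP 1 `|\det w|.
  apply: (submodular_gap r1 s1 bdd M0 E0 hE p0 jd fullCBA fullCA); first by rewrite eG.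
  by apply: le_trans hX'; rewrite -eG' mCA ler_peMr // max_minor_ge0.
have fullCBA' : row_full (map_mx intr (row_mx C (row_mx B A')) : 'M[R]_(m + n, p + (p + i))).
  rewrite -max_minor_gt0 eCBA max_minor_mulmx !det_ublock !det1 !mul1r mulr_gt0 //.
  by rewrite max_minor_gt0.
apply: (submodular_gap r1 s1 bdd M0 E0 hE p0 jd fullCBA' fullCA'); last by rewrite eG'.
by apply: le_trans hX; rewrite -eG mBA ler_piMr ?max_minor_ge0 // ltW.
Qed.

Lemma mx_entries_bounded (R : realFieldType) (m n : nat) (c : 'M[R]_(m, n)) :
  exists2 B : R, 0 <= B & forall i q, `|c i q| <= B.
Proof.
exists (\sum_i \sum_q `|c i q|) => [|i q].
  by apply: sumr_ge0 => i _; apply: sumr_ge0.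
rewrite (bigD1 i) //= (bigD1 q) //= -addrA lerDl addr_ge0 //.
  by apply: sumr_ge0.
by apply: sumr_ge0 => a _; apply: sumr_ge0.
Qed.

(** [open_push_all] is applied to [uni c0 *m X j], and undoing [uni c0] costs a constant. The centre
    [c0] will be an interior point of [D0]. *)
Lemma open_push_at (R : realFieldType) (m n J : nat) (c0 : 'M[R]_(m, n)) (rho : R) :
  0 < rho <= 1 -> exists c eta : R, [/\ 0 < c, 0 < eta &
  forall X : (forall j, 'M[R]_(m + n, j)),
  exists Y : 'M[R]_(m, n), (forall i q, `|Y i q - c0 i q| <= rho) /\
  forall Z : 'M[R]_(m, n), (forall i q, `|Z i q - Y i q| <= eta) ->
  forall j, (j < J)%N -> row_full (X j) ->
  exists f : {ffun 'I_j -> 'I_(m + n)}, (minn j m <= left_count f)%N /\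
    c * max_minor (X j) <= `|\det (rowsub f (uni Z *m X j))|].
Proof.
move=> /(open_push_all m n J)[c [eta [c_gt0 eta_gt0 H]]].
have [B B0 hB] := mx_entries_bounded c0.
set N := #|{: 'I_m * 'I_n}|.
have p0 : 0 < (1 + B) ^+ N by rewrite exprn_gt0 // ltr_wpDr.
exists (c / (1 + B) ^+ N), eta; split => //; first by rewrite divr_gt0.
move=> X; have [Y [Y1 Y2]] := H (fun j => uni c0 *m X j).
exists (c0 + Y); split => [i q|Z hZ j jJ full].
  by rewrite mxE addrAC subrr add0r.
have full' : row_full (uni c0 *m X j).
  by rewrite row_full_unit_mul // unitmxE det_uni unitr1.
have hZ' i q : `|(Z - c0) i q - Y i q| <= eta.
  by have := hZ i q; rewrite !mxE opprD addrA.
have [f [f1 f2]] := Y2 _ hZ' j jJ full'; exists f; split => //.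
rewrite mulmxA -uniD subrK in f2; apply: le_trans f2.
rewrite -mulrA; apply: ler_wpM2l; first exact: ltW.
rewrite ler_pdivrMl //.
have hB' i q : `|(- c0) i q| <= B by rewrite mxE normrN.
have [le _] := uni_near (uni c0 *m X j) B0 hB'.
by rewrite mulmxA -uniD addNr uni0 mul1mx in le.
Qed.

(** The order of quantifiers lets Alice fix [a] before [b] is known: [c] and [eta] do not depend on
    [T], only [M0] does. Subgroups that are not short survive any allowed move; short ones have the
    real span of the chosen subgroup of their rank, whose covolume does not decrease. *)
Lemma lattice_bounded_step (R : realType) (m n : nat) (r : 'I_m -> R) (s : 'I_n -> R)
    (lambda rho : R) (c0 : 'M[R]_(m, n)) :
  (forall i, 0 < r i) -> (forall q, 0 < s q) ->
  \sum_i r i = 1 -> \sum_q s q = 1 ->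
  (forall i, lambda <= r i) -> (forall q, lambda <= s q) ->
  0 < rho <= 1 -> exists c eta : R, [/\ 0 < c, 0 < eta &
  forall T, 0 <= T -> 1 <= c * expR (lambda * T) ->
  exists2 M0 : R, 0 <= M0 & forall M t h, M0 <= M -> lattice_bounded r s M t h ->
  exists Y : 'M[R]_(m, n), (forall i q, `|Y i q - c0 i q| <= rho) /\
  forall Z : 'M[R]_(m, n), (forall i q, `|Z i q - Y i q| <= eta) ->
  lattice_bounded r s M (t + T) (h + weight_flow r s t Z)].
Proof.
move=> r0 s0 r1 s1 lr ls rho01.
have [c [eta [c_gt0 eta_gt0 H]]] := open_push_at (m + n) c0 rho01.
exists c, eta; split => // T T0 cT.
have [B B0 hB] := mx_entries_bounded c0.
pose B1 := B + rho + eta.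
have B10 : 0 <= B1 by rewrite /B1; lra.
set N := #|{: 'I_m * 'I_n}|.
(* [E] bounds the factor by which one round can shrink a covolume: the flow during [T] and a
   translation with entries at most [B1]. *)
pose E := expR ((m + n)%:R * T) * (1 + B1) ^+ N.
have E0 : 0 <= E by rewrite mulr_ge0 ?expR_ge0 // exprn_ge0 // addr_ge0.
pose F := ((2 * (m + n))`!)%:R * E ^+ 2.
have F0 : 0 <= F by rewrite mulr_ge0 // exprn_ge0.
exists F => // M t h FM bdd.
have M0 : 0 <= M := le_trans F0 FM.
have hE : F < expR (2 * M).
  apply: lt_le_trans (expR_ge1Dx _); lra.
set G := lattice_mx r s t h.
have uG : G \in unitmx by rewrite unitmxE det_lattice_mx // unitr1.
pose short j (V : 'M[int]_(m + n, j)) := row_full (map_mx intr V : 'M[R]_(m + n, j)) /\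
  max_minor (G *m map_mx intr V) <= E * expR (- (M * rank_weight R (m + n) j)).
have [V hV] : exists V : forall j, 'M[int]_(m + n, j),
    forall j, (exists W, @short j W) -> short j (V j).
  exists (fun j => xget 0 (@short j)) => j; exact: xgetPex.
have [Y [Y1 Y2]] := H (fun j => G *m map_mx intr (V j)).
exists Y; split => // Z hZ j X /andP[j0 jd] full.
have hZB i q : `|Z i q| <= B1.
  have -> : Z i q = c0 i q + (Y i q - c0 i q) + (Z i q - Y i q) by ring.
  apply: le_trans (ler_normD _ _) _; rewrite lerD //.
  by apply: le_trans (ler_normD _ _) _; rewrite lerD.
have -> : lattice_mx r s (t + T) (h + weight_flow r s t Z) *m map_mx intr X =
    flow_mx r s T *m (uni Z *m (G *m map_mx intr X)).
  by rewrite lattice_mx_step !mulmxA.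
have [long|le] := ltP (E * expR (- (M * rank_weight R (m + n) j)))
    (max_minor (G *m map_mx intr X)).
  have h1 := max_minor_flow_ge T (uni Z *m (G *m map_mx intr X)) r0 s0 r1 s1.
  have hZN i q : `|(- Z) i q| <= B1 by rewrite mxE normrN.
  have [h2 _] := uni_near (uni Z *m (G *m map_mx intr X)) B10 hZN.
  rewrite [uni (- Z) *m _]mulmxA -uniD addNr uni0 mul1mx -/N in h2.
  have p1 : 0 < (1 + B1) ^+ N by rewrite exprn_gt0 // ltr_wpDr.
  have {long h2} long := lt_le_trans long h2.
  rewrite -ltr_pdivrMl // in long; apply: le_trans h1; rewrite ger0_norm //.
  rewrite [expR (- (j%:R * T))]expRN ler_pdivlMl ?expR_gt0 //.
  apply: le_trans (ltW long); rewrite /E.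
  have -> : ((1 + B1) ^+ N)^-1 *
     (expR ((m + n)%:R * T) * (1 + B1) ^+ N * expR (- (M * rank_weight R (m + n) j))) =
     expR ((m + n)%:R * T) * expR (- (M * rank_weight R (m + n) j)).
    by field; rewrite gt_eqF.
  by rewrite ler_wpM2r ?expR_ge0 // ler_expR ler_wpM2r // ler_nat ltnW.
have [fullV hVE] := hV j (ex_intro _ X (conj full le)).
have [z ez] := short_subgroups_commensurable r1 s1 bdd M0 E0 hE jd fullV full hVE le.
have fullGV : row_full (G *m map_mx intr (V j)) by rewrite row_full_unit_mul.
have [f [f1 f2]] := Y2 Z hZ j jd fullGV.
have := bdd j X; rewrite j0 jd => /(_ isT full) /le_trans; apply.
(* Before and after the round, the covolume of [X] is that of [V j] times the same factor [\det z]
   up to sign, which cancels. *)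
rewrite ez [G *m _]mulmxA [uni Z *m _]mulmxA [flow_mx r s T *m _]mulmxA.
rewrite !max_minor_mulmx ler_wpM2r //.
have := minor_le (flow_mx r s T *m (uni Z *m (G *m map_mx intr (V j)))) f.
apply: le_trans; rewrite det_rowsub_flow normrM gtr0_norm ?expR_gt0 //.
have GV0 : 0 < max_minor (G *m map_mx intr (V j)) by rewrite max_minor_gt0.
have d0 : \det (rowsub f (uni Z *m (G *m map_mx intr (V j)))) != 0.
  by rewrite -normr_gt0; apply: lt_le_trans f2; rewrite mulr_gt0.
have jd' : (0 < j < m + n)%N by rewrite j0.
have wf := left_minor_weight r0 s0 r1 s1 lr ls jd' (det_rowsub_inj d0) f1.
apply: (@le_trans _ _ (expR (lambda * T) * (c * max_minor (G *m map_mx intr (V j))))).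
  by rewrite mulrA ler_peMl ?max_minor_ge0 // mulrC.
apply: ler_pM; rewrite ?expR_ge0 //; first by rewrite mulr_ge0 ?max_minor_ge0 // ltW.
by rewrite ler_expR ler_wpM2r.
Qed.

(** * Bounded trajectories and [Bad] *)

Lemma lattice_mxE_lshift (R : realType) (m n : nat) (r : 'I_m -> R) (s : 'I_n -> R)
    (t : R) (Y : 'M[R]_(m, n)) (a : 'cV[R]_m) (b : 'cV[R]_n) i :
  (lattice_mx r s t Y *m col_mx a b) (lshift n i) 0 =
  expR (r i * t) * (a i 0 + (row i Y *m b) 0 0).
Proof.
rewrite -mulmxA flow_mxE flow_weight_lshift /uni mul_block_col col_mxEu.
by rewrite mul1mx mxE -row_mul [in RHS]mxE.
Qed.

Lemma lattice_mxE_rshift (R : realType) (m n : nat) (r : 'I_m -> R) (s : 'I_n -> R)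
    (t : R) (Y : 'M[R]_(m, n)) (a : 'cV[R]_m) (b : 'cV[R]_n) q :
  (lattice_mx r s t Y *m col_mx a b) (rshift m q) 0 = expR (- s q * t) * b q 0.
Proof.
rewrite -mulmxA flow_mxE flow_weight_rshift /uni mul_block_col col_mxEd.
by rewrite mul0mx add0r mul1mx.
Qed.

Lemma row_full_col (F : realFieldType) (d : nat) (v : 'cV[F]_d) x :
  v x 0 != 0 -> row_full v.
Proof.
move=> vx; rewrite -max_minor_gt0; apply: lt_le_trans (minor_le v [ffun=> x]).
by rewrite det_mx11 !mxE ffunE normr_gt0.
Qed.

Lemma powR_expR_ln (R : realType) (a x : R) : 0 < a -> a `^ x = expR (x * ln a).
Proof. by move=> a0; rewrite /powR gt_eqF. Qed.

(** The least such [k] works: the previous time is below [tau], and the term in [t1] covers [k = 0],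
    where there is no previous time. *)
Lemma first_time (R : realType) (t1 T tau : R) : 0 < T -> 0 <= tau ->
  exists2 k : nat, tau <= t1 + k%:R * T & t1 + k%:R * T <= tau + T + `|t1|.
Proof.
move=> T0 tau0; have ex : exists k : nat, tau <= t1 + k%:R * T.
  have := archi_boundP (divr_ge0 (addr_ge0 tau0 (normr_ge0 t1)) (ltW T0)).
  rewrite ltr_pdivrMr // => h; exists (Num.bound ((tau + `|t1|) / T)).
  have := ler_norm (- t1); rewrite normrN; lra.
case: (ex_minnP ex) => k hk kmin; exists k => //.
case: k hk kmin => [|k] _ kmin.
  by rewrite mul0r addr0; have := ler_norm t1; lra.
have : ~~ (tau <= t1 + k%:R * T) by apply/negP => /kmin; rewrite ltnn.
rewrite -ltNge -natr1 mulrDl mul1r; have := normr_ge0 t1; lra.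
Qed.

(* The Dani correspondence: the product defining [Bad] is bounded below by
   looking at the lattice at the first time [t] such that [expR t] exceeds a
   fixed multiple of [max_q `|q|^(1/s)]; by then the last [n] coordinates are
   too small to account for the length of the vector. *)
Lemma Bad_of_bounded (R : realType) (m n : nat) (r : 'I_m -> R) (s : 'I_n -> R)
    (lambda eps t1 T : R) (Y : 'M[R]_(m, n)) :
  (0 < n)%N -> 0 < lambda -> (forall i, lambda <= r i) -> (forall q, lambda <= s q) ->
  0 < eps <= 1 -> 0 < T ->
  (forall (k : nat) (v : 'cV[int]_(m + n)), v != 0 ->
     eps <= max_minor (lattice_mx r s (t1 + k%:R * T) Y *m map_mx intr v)) ->
  Bad r s Y.
Proof.
move=> n0 l0 lr ls /andP[e0 e1] T0 H.
(* Here [lambda * kappa] is the inverse of [eps], and [1 + x <= expR x] gives [hkappa]: waiting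
   [kappa] longer brings the last [n] coordinates below [eps]. *)
pose kappa := (eps * lambda)^-1.
have k0 : 0 < kappa by rewrite invr_gt0 mulr_gt0.
have hkappa : expR (- (lambda * kappa)) < eps.
  rewrite expRN invf_plt ?posrE ?expR_gt0 //; apply: lt_le_trans (expR_ge1Dx _).
  by rewrite /kappa invfM mulrCA divff ?mulr1 ?ltrDr ?gt_eqF.
(* The time used is at most [ln Q + kappa + T] plus the absolute value of [t1], and [P] is at least
   [expR (ln eps / lambda - t)]; this is the resulting bound on [P * Q]. *)
pose delta := expR (ln eps / lambda - kappa - T - `|t1|).
suff key (p : 'cV[int]_m) (q : 'cV[int]_n) : q != 0 -> delta <= approx_quality r s Y p q.
  rewrite /Bad /=; apply: (@lt_le_trans _ _ delta); first exact: expR_gt0.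
  apply: lb_le_inf; last by move=> x [p [q [q0 ->]]]; apply: key.
  (* The lower bound passes to [inf] only for a nonempty set, hence this witness. *)
  exists (approx_quality r s Y 0 (const_mx 1)), 0, (const_mx 1); split => //.
  by apply/cV0Pn; exists (Ordinal n0); rewrite mxE oner_eq0.
move=> q0; rewrite /approx_quality.
set P := \big[_/_]_(i < m) _; set Q := \big[_/_]_(j < n) _.
have leQ j : `|(q j 0)%:~R| `^ (1 / s j) <= Q.
  exact: (le_bigmax_cond _ (fun j => `|(q j 0)%:~R| `^ (1 / s j))).
have leP i : `|(row i Y *m map_mx intr q) 0 0 - (p i 0)%:~R| `^ (1 / r i) <= P.
  exact: (le_bigmax_cond _
    (fun i => `|(row i Y *m map_mx intr q) 0 0 - (p i 0)%:~R| `^ (1 / r i))).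
have Q1 : 1 <= Q.
  have /cV0Pn[j qj] := q0; apply: le_trans (leQ j).
  have qj1 : 1 <= `|(q j 0)%:~R| :> R by rewrite -intr_norm ler1z -gtz0_ge1 normr_gt0.
  rewrite powR_expR_ln ?(lt_le_trans ltr01) //; apply: le_trans (expR_ge1Dx _).
  by rewrite lerDl mulr_ge0 ?ln_ge0 // divr_ge0 // (le_trans (ltW l0)).
have Q0 : 0 < Q := lt_le_trans ltr01 Q1.
have tau0 : 0 <= ln Q + kappa by rewrite addr_ge0 ?ln_ge0 // ltW.
have [k tk1 tk2] := first_time t1 T0 tau0; set t := t1 + _ in tk1 tk2.
have v0 : col_mx (- p) q != 0.
  by apply: contraNneq q0 => /eqP; rewrite col_mx_eq0 => /andP[].
have := H k _ v0; rewrite -/t map_col_mx; set L := _ *m _ => hL.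
have [f ef] := max_minor_attained (lt_le_trans e0 hL).
move: hL; rewrite ef det_mx11 mxE /L; case: (split_ordP (f 0)) => [i ->|j ->].
  rewrite lattice_mxE_lshift normrM gtr0_norm ?expR_gt0 //.
  rewrite (_ : map_mx intr (- p) i 0 = - (p i 0)%:~R); last by rewrite !mxE intrN.
  rewrite [- _ + _]addrC; set u := _ - _ => hu.
  have u0 : 0 < `|u| by rewrite -(pmulr_rgt0 _ (expR_gt0 (r i * t))) (lt_le_trans e0).
  have ri0 : 0 < r i := lt_le_trans l0 (lr i).
  have lnu : ln eps - r i * t <= ln `|u|.
    rewrite -ler_expR lnK ?posrE // expRD lnK ?posrE // expRN.
    by rewrite ler_pdivrMr ?expR_gt0 // mulrC.
  have hP : expR (ln eps / lambda - t) <= P.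
    apply: le_trans (leP i); rewrite -/u powR_expR_ln // ler_expR mul1r.
    rewrite ler_pdivlMl //; apply: le_trans lnu.
    (* As [ln eps <= 0], dividing it by [lambda] instead of the larger [r i] only lowers the
       value. *)
    rewrite mulrBr lerD2r mulrA ler_pdivrMr // mulrC ler_wnM2l ?ln_le0 //.
  rewrite -[Q]lnK ?posrE //; apply: (@le_trans _ _ (expR (ln eps / lambda - t) * expR (ln Q))).
    by rewrite -expRD ler_expR; lra.
  by rewrite ler_wpM2r ?expR_ge0.
rewrite lattice_mxE_rshift mxE normrM gtr0_norm ?expR_gt0 // leNgt => /negP[].
have sj0 : 0 < s j := lt_le_trans l0 (ls j).
have [->|qj] := eqVneq (q j 0) 0; first by rewrite normr0 mulr0.
have qj0 : 0 < `|(q j 0)%:~R| :> R by rewrite normr_gt0 intr_eq0.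
have := leQ j; rewrite powR_expR_ln // -{1}[Q]lnK ?posrE // ler_expR mul1r ler_pdivrMl //.
move=> hq; apply: le_lt_trans hkappa; rewrite -[X in _ * X]lnK ?posrE // -expRD ler_expR.
have : lambda * kappa <= s j * (t - ln Q).
  by apply: ler_pM; [exact: ltW | exact: ltW | exact: ls | lra].
lra.
Qed.

(** * The game *)

Local Open Scope classical_set_scope.

Lemma weight_flowE (R : realType) (m n : nat) (r : 'I_m -> R) (s : 'I_n -> R) t
    (Y : 'M[R]_(m, n)) i q : weight_flow r s t Y i q = expR (- (r i + s q) * t) * Y i q.
Proof. by rewrite mxE. Qed.

Lemma weight_flowD (R : realType) (m n : nat) (r : 'I_m -> R) (s : 'I_n -> R) t u
    (Y : 'M[R]_(m, n)) :
  weight_flow r s (t + u) Y = weight_flow r s t (weight_flow r s u Y).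
Proof.
by apply/matrixP => i q; rewrite !weight_flowE mulrA -expRD; congr (expR _ * _); ring.
Qed.

Lemma weight_flow_add (R : realType) (m n : nat) (r : 'I_m -> R) (s : 'I_n -> R) t
    (Y Z : 'M[R]_(m, n)) :
  weight_flow r s t (Y + Z) = weight_flow r s t Y + weight_flow r s t Z.
Proof. by apply/matrixP => i q; rewrite !mxE mulrDr. Qed.

Lemma weight_flowK (R : realType) (m n : nat) (r : 'I_m -> R) (s : 'I_n -> R) t :
  cancel (weight_flow r s (- t)) (weight_flow r s t).
Proof.
move=> Y; rewrite -weight_flowD subrr; apply/matrixP => i q.
by rewrite weight_flowE mulr0 expR0 mul1r.
Qed.

Lemma addmxE (R : nmodType) (m n : nat) (Y Z : 'M[R]_(m, n)) i q :
  (Y + Z) i q = Y i q + Z i q.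
Proof. by rewrite mxE. Qed.

Definition flow_translate (R : realType) (m n : nat) (r : 'I_m -> R) (s : 'I_n -> R)
    (D0 : set 'M[R]_(m, n)) (t : R) (h : 'M[R]_(m, n)) : set 'M[R]_(m, n) :=
  [set x + h | x in weight_flow r s t @` D0].

Lemma flow_translateP (R : realType) (m n : nat) (r : 'I_m -> R) (s : 'I_n -> R)
    (D0 : set 'M[R]_(m, n)) (t : R) (h x : 'M[R]_(m, n)) :
  flow_translate r s D0 t h x <-> exists2 z, D0 z & x = weight_flow r s t z + h.
Proof.
split=> [[_ [z Dz <-] <-]|[z Dz ->]]; first by exists z.
by exists (weight_flow r s t z) => //; exists z.
Qed.

Lemma translatesP (R : realType) (m n : nat) (r : 'I_m -> R) (s : 'I_n -> R)
    (D0 : set 'M[R]_(m, n)) (t : R) (S : set 'M[R]_(m, n)) :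
  translates (weight_flow r s) D0 t S <-> exists h, S = flow_translate r s D0 t h.
Proof. by split=> [[h _ <-]|[h ->]]; exists h. Qed.

Lemma compact_cluster_seq (R : realType) (m n : nat) (D0 : set 'M[R]_(m, n))
    (z : nat -> 'M[R]_(m, n)) :
  compact D0 -> (forall l, D0 (z l)) ->
  exists2 p, D0 p & forall (e : R) (N : nat), 0 < e ->
    exists2 l, (N <= l)%N & forall i q, `|p i q - z l i q| < e.
Proof.
move=> cD Dz; have [|p [Dp clp]] := cD (z @ \oo) _; first by exists 0%N => // l _; apply: Dz.
exists p => // e N e0.
have FA : (z @ \oo) (z @` [set l | (N <= l)%N]) by exists N => // l /= Nl; exists l.
have [_ [[l /= Nl <-] [_ hb]]] := clp _ _ FA (nbhsx_ballx p e e0).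
by exists l => // i q; apply: hb.
Qed.

Lemma compact_entries_bounded (R : realType) (m n : nat) (D0 : set 'M[R]_(m, n)) :
  compact D0 -> exists2 B : R, 0 <= B & forall (x : 'M[R]_(m, n)) i q, D0 x -> `|x i q| <= B.
Proof.
move=> cD; apply: contrapT => nob.
have unb (l : nat) : exists x : 'M[R]_(m, n), D0 x /\ exists i q, l%:R < `|x i q|.
  apply: contrapT => no; apply: nob; exists l%:R => // x i q Dx.
  by rewrite leNgt; apply/negP => h; apply: no; exists x; split => //; exists i, q.
have [z zP] := choice unb.
have [p Dp clp] := compact_cluster_seq cD (fun l => (zP l).1).
have [B B0 hB] := mx_entries_bounded p.
have [l Nl hl] := clp 1 (Num.bound (B + 1)) ltr01.
have [_ [i [q hz]]] := zP l.
have := archi_boundP (addr_ge0 B0 ler01).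
have : (Num.bound (B + 1))%:R <= l%:R :> R by rewrite ler_nat.
have := lerB_dist (z l i q) (p i q); rewrite distrC; have := hl i q; have := hB i q.
lra.
Qed.

Lemma interior_entries (R : realType) (m n : nat) (D0 : set 'M[R]_(m, n)) :
  interior D0 !=set0 -> exists (c : 'M[R]_(m, n)) (rho : R),
  0 < rho <= 1 /\ forall Y : 'M[R]_(m, n), (forall i q, `|Y i q - c i q| <= rho) -> D0 Y.
Proof.
case=> c /nbhs_ballP [e /= e0 sub]; exists c, (Num.min 1 (e / 2)); split.
  by rewrite ge_min lexx andbT lt_min ltr01; lra.
move=> Y hY; apply: sub; split => // i q.
rewrite /ball /= distrC; apply: le_lt_trans (hY i q) _.
by rewrite gt_min; apply/orP; right; lra.
Qed.

Lemma weight_flow_le (R : realType) (m n : nat) (r : 'I_m -> R) (s : 'I_n -> R)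
    (lambda t B : R) (Y : 'M[R]_(m, n)) i q :
  0 < lambda -> (forall i, lambda <= r i) -> (forall q, lambda <= s q) ->
  0 <= t -> `|Y i q| <= B -> `|weight_flow r s t Y i q| <= expR (- (lambda * t)) * B.
Proof.
move=> l0 lr ls t0 hB; rewrite weight_flowE normrM gtr0_norm ?expR_gt0 //.
apply: ler_pM => //; rewrite ?expR_ge0 // ler_expR mulNr lerN2 ler_wpM2r //.
by have := lr i; have := ls q; lra.
Qed.

(** If [astar] were negative, an expanding map followed by a translation would send [D0] into
    itself, and iterating it would separate two points without bound, against compactness. The sign
    ensures that a full round lasts at least [a]. *)
Lemma threshold_ge0 (R : realType) (m n : nat) (r : 'I_m -> R) (s : 'I_n -> R)
    (D0 : set 'M[R]_(m, n)) (astar : R) :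
  (0 < m)%N -> (0 < n)%N -> (forall i, 0 < r i) -> (forall q, 0 < s q) ->
  admissible D0 -> msg_threshold (weight_flow r s) D0 astar -> 0 <= astar.
Proof.
move=> m0 n0 r0 s0 [cD iD] thr; rewrite leNgt; apply/negP => a0.
pose i0 := Ordinal m0; pose q0 := Ordinal n0.
have [B B0 hB] := compact_entries_bounded cD.
have [c [rho [/andP[rho0 _] hc]]] := interior_entries iD.
have [_ /translatesP[h ->] sub] :
    exists2 S, translates (weight_flow r s) D0 (astar / 2) S & S `<=` D0.
  by apply: thr; lra.
set x := - (r i0 + s q0) * (astar / 2).
have x0 : 0 < x.
  by rewrite /x nmulr_rgt0 ?oppr_lt0 ?addr_gt0 //; lra.
have grow (k : nat) : exists y z : 'M[R]_(m, n),
    [/\ D0 y, D0 z & expR (k%:R * x) * rho <= y i0 q0 - z i0 q0].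
  elim: k => [|k [y [z [Dy Dz hk]]]].
    exists (c + const_mx rho), c; split.
    - by apply: hc => i q; rewrite !mxE addrAC subrr add0r gtr0_norm.
    - by apply: hc => i q; rewrite subrr normr0 ltW.
    - by rewrite !mxE mul0r expR0 mul1r addrAC subrr add0r.
  exists (weight_flow r s (astar / 2) y + h), (weight_flow r s (astar / 2) z + h); split.
  - by apply: sub; apply/flow_translateP; exists y.
  - by apply: sub; apply/flow_translateP; exists z.
  rewrite !mxE -/x -natr1 mulrDl mul1r addrC expRD -mulrA.
  have := ler_wpM2l (expR_ge0 x) hk; lra.
have := archi_boundP (divr_ge0 (mulr_ge0 (ltW (ltr0Sn R 1)) B0)
  (mulr_ge0 (ltW x0) (ltW rho0))).
have xr := mulr_gt0 x0 rho0.
set k := Num.bound _; rewrite ltr_pdivrMr // => hk.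
have [y [z [Dy Dz]]] := grow k.
have := ler_wpM2r (ltW rho0) (expR_ge1Dx (k%:R * x)).
have := hB _ i0 q0 Dy; have := hB _ i0 q0 Dz.
have := ler_norm (y i0 q0); have := ler_norm (- z i0 q0); rewrite normrN; lra.
Qed.

Lemma eps_eq (R : realType) (x y : R) : (forall e, 0 < e -> `|x - y| <= e) -> x = y.
Proof.
move=> h; apply/eqP; rewrite -subr_eq0 -normr_le0; apply/ler_addgt0Pr => e e0.
by rewrite add0r h.
Qed.

(** By compactness of [D0], each [A k] contains a cluster point of one sequence of points [x l]
    taken in the successive sets. The diameters tend to zero, so all these cluster points
    coincide. *)
Lemma nested_translates (R : realType) (m n : nat) (r : 'I_m -> R) (s : 'I_n -> R)
    (lambda t1 T : R) (D0 : set 'M[R]_(m, n)) (g : nat -> 'M[R]_(m, n)) :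
  0 < lambda -> (forall i, lambda <= r i) -> (forall q, lambda <= s q) -> 0 < T ->
  compact D0 -> D0 !=set0 ->
  let A k := flow_translate r s D0 (t1 + k%:R * T) (g k) in
  (forall k, A k.+1 `<=` A k) -> exists x, \bigcap_k A k = [set x].
Proof.
move=> l0 lr ls T0 cD [x0 Dx0] A nest.
have [B B0 hB] := compact_entries_bounded cD.
have mono k l : (k <= l)%N -> A l `<=` A k.
  move/subnKC <-; elim: (l - k)%N => [|d IH]; first by rewrite addn0.
  by rewrite addnS; apply: subset_trans IH; apply: nest.
have small e : 0 < e -> exists K,
    forall (x y : 'M[R]_(m, n)) i q, A K x -> A K y -> `|x i q - y i q| <= e.
  move=> e0; have tau0 : 0 <= B * 2 / (lambda * e).
    by rewrite divr_ge0 ?mulr_ge0 // ltW // mulr_gt0.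
  have [K hK _] := first_time t1 T0 tau0; set t := t1 + _ in hK.
  exists K => x y i q /flow_translateP[u Du ->] /flow_translateP[v Dv ->]; rewrite -/t.
  have t0 : 0 <= t := le_trans tau0 hK.
  have h1 := weight_flow_le l0 lr ls t0 (hB u i q Du).
  have h2 := weight_flow_le l0 lr ls t0 (hB v i q Dv).
  rewrite !addmxE opprD addrACA subrr addr0; apply: le_trans (ler_normB _ _) _.
  apply: le_trans (lerD h1 h2) _; rewrite -mulr2n -mulr_natr -mulrA.
  rewrite expRN mulrC ler_pdivrMr ?expR_gt0 // mulrC.
  rewrite ler_pdivrMr ?mulr_gt0 // in hK.
  have := ler_wpM2r (ltW e0) (expR_ge1Dx (lambda * t)); nra.
pose x k : 'M[R]_(m, n) := weight_flow r s (t1 + k%:R * T) x0 + g k.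
have xA k l : (k <= l)%N -> A k (x l).
  by move=> kl; apply: (mono k l kl); apply/flow_translateP; exists x0.
have lim k : exists2 X, A k X & forall (e : R) (N : nat), 0 < e ->
    exists2 l, (N <= l)%N & forall i q, `|X i q - x l i q| <= e.
  have pre l : exists z, D0 z /\ x (k + l)%N = weight_flow r s (t1 + k%:R * T) z + g k.
    by have /flow_translateP[z Dz ez] := xA k (k + l)%N (leq_addr l k); exists z.
  have [z zP] := choice pre.
  have [p Dp hp] := compact_cluster_seq cD (fun l => (zP l).1).
  exists (weight_flow r s (t1 + k%:R * T) p + g k); first by apply/flow_translateP; exists p.
  move=> e N e0.
  (* [C] bounds the factors of [weight_flow] at this time, which exceed [1] when the time is
     negative. *)
  have [C C0 hC] := mx_entries_bounded (\matrix_(i, q) expR (- (r i + s q) * (t1 + k%:R * T))).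
  have C1 : 0 < C + 1 by rewrite ltr_wpDl.
  have [l Nl hl] := hp (e / (C + 1)) N (divr_gt0 e0 C1).
  exists (k + l)%N => [|i q]; first exact: (leq_trans Nl (leq_addl _ _)).
  rewrite (zP l).2 !addmxE opprD addrACA subrr addr0 !weight_flowE -mulrBr normrM.
  have := hC i q; rewrite mxE => hC'.
  have := ltW (hl i q); rewrite ler_pdivlMr // => hl'; apply: le_trans hl'.
  by rewrite mulrC ler_wpM2l //; lra.
have [X A0X hX] := lim 0%N; exists X; apply/seteqP; split => y.
  move=> Ay /=; apply/matrixP => i q; apply: eps_eq => e e0.
  have e20 : 0 < e / 2 by lra.
  have [K hK] := small _ e20; have [l Kl hl] := hX _ K e20.
  have := hK y (x l) i q (Ay K I) (xA K l Kl); have := hl i q.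
  have -> : y i q - X i q = (y i q - x l i q) - (X i q - x l i q) by ring.
  by have := ler_normB (y i q - x l i q) (X i q - x l i q); lra.
move=> -> k _; have [Xk AkX hXk] := lim k.
suff -> : X = Xk by [].
apply/matrixP => i q; apply: eps_eq => e e0.
have e30 : 0 < e / 3 by lra.
have [K hK] := small _ e30; have [l Kl hl] := hX _ K e30; have [l' Kl' hl'] := hXk _ K e30.
have := hK (x l) (x l') i q (xA K l Kl) (xA K l' Kl'); have := hl i q; have := hl' i q.
have -> : X i q - Xk i q =
    (X i q - x l i q) + (x l i q - x l' i q) - (Xk i q - x l' i q) by ring.
have := ler_normB ((X i q - x l i q) + (x l i q - x l' i q)) (Xk i q - x l' i q).
have := ler_normD (X i q - x l i q) (x l i q - x l' i q); lra.
Qed.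

(** Integer matrices of full rank have a minor of absolute value at least [1], and passing to time
    [t] and centre [h] loses at most [K]. As [rank_weight] is at least [1] in intermediate ranks,
    any [M >= K] works; it depends on Bob's first move. *)
Lemma lattice_bounded_init (R : realType) (m n : nat) (r : 'I_m -> R) (s : 'I_n -> R)
    (t M0 : R) (h : 'M[R]_(m, n)) :
  (forall i, 0 < r i) -> (forall q, 0 < s q) ->
  \sum_i r i = 1 -> \sum_q s q = 1 ->
  exists M, M0 <= M /\ lattice_bounded r s M t h.
Proof.
move=> r0 s0 r1 s1; have [B B0 hB] := mx_entries_bounded h.
set N := #|{: 'I_m * 'I_n}|.
have p0 : 0 < (1 + B) ^+ N by rewrite exprn_gt0 // ltr_wpDr.
pose K := expR ((m + n)%:R * `|t|) * (1 + B) ^+ N.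
have K0 : 0 < K by rewrite mulr_gt0 ?expR_gt0.
exists (Num.max M0 K); split; first by rewrite le_max lexx.
set M := Num.max _ _; have KM : K <= M by rewrite le_max lexx orbT.
move=> j X /andP[j0 jd] full.
have X1 := max_minor_int_ge1 full.
have hB' i q : `|(- h) i q| <= B by rewrite mxE normrN.
have [h1 _] := uni_near (uni h *m map_mx intr X) B0 hB'.
rewrite mulmxA -uniD addNr uni0 mul1mx -/N in h1.
have h2 := max_minor_flow_ge t (uni h *m map_mx intr X) r0 s0 r1 s1.
rewrite -mulmxA; apply: le_trans h2.
rewrite expRN [expR (- _)]expRN ler_pdivlMl ?expR_gt0 // ler_pdivrMr ?expR_gt0 //.
have w1 : 1 <= rank_weight R (m + n) j.
  by rewrite /rank_weight -(natrB _ (ltnW jd)) -natrM ler1n muln_gt0 j0 subn_gt0.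
have M0' : 0 <= M := le_trans (ltW K0) KM.
have h3 : K <= expR (M * rank_weight R (m + n) j).
  apply: le_trans (expR_ge1Dx _); have := ler_wpM2l M0' w1; lra.
have h4 : expR (j%:R * `|t|) * (1 + B) ^+ N <= K.
  apply: ler_wpM2r; first exact: ltW.
  by rewrite ler_expR ler_wpM2r // ler_nat ltnW.
have h5 := le_trans X1 h1.
apply: le_trans (ler_peMr (expR_ge0 _) h5) _; rewrite mulrA mulrC ler_wpM2l ?max_minor_ge0 //.
exact: le_trans h4 h3.
Qed.

Lemma min_weight (R : realType) (m n : nat) (r : 'I_m -> R) (s : 'I_n -> R) :
  (forall i, 0 < r i) -> (forall q, 0 < s q) ->
  exists lambda : R, [/\ 0 < lambda, forall i, lambda <= r i & forall q, lambda <= s q].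
Proof.
move=> r0 s0.
exists (Num.min (\big[Num.min/1]_i r i) (\big[Num.min/1]_q s q)); split.
- rewrite lt_min; apply/andP; split; apply: lt_bigmin => //.
- by move=> i; rewrite ge_min; apply/orP; left; apply: bigmin_le_cond.
- by move=> q; rewrite ge_min; apply/orP; right; apply: bigmin_le_cond.
Qed.

Theorem corollary8p1 (R : realType) (m n : nat) (hm : (0 < m)%N) (hn : (0 < n)%N)
    (r : 'I_m -> R) (s : 'I_n -> R)
    (hr : forall i : 'I_m, 0 < r i) (hs : forall j : 'I_n, 0 < s j)
    (hr1 : \sum_(i < m) r i = 1) (hs1 : \sum_(j < n) s j = 1)
    (D0 : set 'M[R]_(m, n)) (hD0 : admissible D0)
    (astar : R) (hastar : msg_threshold (weight_flow r s) D0 astar) :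
  winning (weight_flow r s) D0 astar (Bad r s).
Proof.
have astar0 := threshold_ge0 hm hn hr hs hD0 hastar.
have [cD iD] := hD0.
have [lambda [l0 lr ls]] := min_weight hr hs.
have [B B0 hB] := compact_entries_bounded cD.
have [c0 [rho [/andP[rho0 rho1] hc0]]] := interior_entries iD.
have Dc0 : D0 c0 by apply: hc0 => i q; rewrite subrr normr0 ltW.
(* Alice's displacement uses half of [rho]; the size of her set uses the other half. *)
have rho2 : 0 < rho / 2 <= 1 by lra.
have [c [eta [c_gt0 eta_gt0 stepP]]] := lattice_bounded_step c0 hr hs hr1 hs1 lr ls rho2.
(* The three terms ensure in turn that expansion beats [c] for every [b], that Bob's displacements
   stay within [eta] of Alice's choice, and that Alice's set fits in Bob's. *)
pose K := c^-1 + 2 * B / eta + 2 * B / rho.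
have K1 : c^-1 <= K by rewrite /K -addrA lerDl addr_ge0 // divr_ge0 ?mulr_ge0 // ltW.
have K2 : 2 * B / eta <= K.
  by rewrite /K addrAC lerDr addr_ge0 ?invr_ge0 ?divr_ge0 ?mulr_ge0 // ltW.
have K3 : 2 * B / rho <= K.
  by rewrite /K lerDr addr_ge0 ?invr_ge0 ?divr_ge0 ?mulr_ge0 // ltW.
have K0 : 0 < K by apply: lt_le_trans K1; rewrite invr_gt0.
have [a [a_star a0 aK]] : exists a, [/\ astar < a, 0 < a & K <= expR (lambda * a)].
  exists (astar + 1 + K / lambda); have : 0 < K / lambda by rewrite divr_gt0.
  split; [lra | lra |]; apply: le_trans (expR_ge1Dx _).
  have -> : lambda * (astar + 1 + K / lambda) = lambda * (astar + 1) + K.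
    by field; rewrite gt_eqF.
  have : 0 <= lambda * (astar + 1) by apply: mulr_ge0; lra.
  lra.
have smallB t d : a <= t -> 0 < d -> 2 * B / d <= K -> expR (- (lambda * t)) * B <= d / 2.
  move=> at_ d0 hd; rewrite expRN mulrC ler_pdivrMr ?expR_gt0 //.
  have : expR (lambda * a) <= expR (lambda * t) by rewrite ler_expR ler_wpM2l // ltW.
  rewrite ler_pdivrMr // in hd; move=> h1.
  have := ler_wpM2r (ltW d0) (le_trans aK h1); lra.
exists a => // b hb; set Phi := weight_flow r s.
pose T := a + b; have b0 : 0 <= b by apply: le_trans (ltW hb).
have aT : a <= T by rewrite lerDl.
have T0 : 0 < T := lt_le_trans a0 aT.
have cT : 1 <= c * expR (lambda * T).
  rewrite -ler_pdivrMl // mulr1; apply: le_trans K1 (le_trans aK _).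
  by rewrite ler_expR ler_wpM2l // ltW.
have [M0 M00 step] := stepP T (ltW T0) cT.
pose tr := flow_translate r s D0.
pose hsel t S : 'M[R]_(m, n) := xget 0 [set h | S = tr t h].
pose Msel t h : R := xget 0 [set M | M0 <= M /\ lattice_bounded r s M t h].
(* The lattice bound is a premise inside [good], so that Alice has a legal answer even when the
   bound fails. *)
pose good M t h (Y : 'M[R]_(m, n)) := tr a Y `<=` D0 /\ (lattice_bounded r s M t h ->
  forall Z : 'M[R]_(m, n), (forall i q, `|Z i q - Y i q| <= eta) ->
  lattice_bounded r s M (t + T) (h + Phi t Z)).
have goodP M t h : M0 <= M -> exists Y, good M t h Y.
  move=> MM0; have inD (Y : 'M[R]_(m, n)) :
      (forall i q, `|Y i q - c0 i q| <= rho / 2) -> tr a Y `<=` D0.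
    move=> hY y /flow_translateP[z Dz ->]; apply: hc0 => i q.
    rewrite addmxE -addrA; apply: le_trans (ler_normD _ _) _.
    have := weight_flow_le l0 lr ls (ltW a0) (hB z i q Dz).
    have := smallB a rho (lexx _) rho0 K3; have := hY i q; lra.
  case: (pselect (lattice_bounded r s M t h)) => [bdd|nbdd].
    by have [Y [Y1 Y2]] := step M t h MM0 bdd; exists Y; split; [apply: inD | move=> _].
  by exists c0; split => //; apply: inD => i q; rewrite subrr normr0; lra.
pose ysel M t h : 'M[R]_(m, n) := xget 0 [set Y | good M t h Y].
(* The history at step [k] has length [k + 1], whence the predecessor. [M] is recomputed from Bob's
   first set and is thus the same at all steps. *)
exists (fun t1 Bs =>
  let t := bob_time a b t1 (size Bs).-1 in
  let h := hsel t (last set0 Bs) in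
  let M := Msel (bob_time a b t1 0) (hsel (bob_time a b t1 0) (head set0 Bs)) in
  tr (t + a) (h + Phi t (ysel M t h))).
move=> t1 Bob A.
pose t k := bob_time a b t1 k; pose h k := hsel (t k) (Bob k).
pose M := Msel (t 0%N) (h 0%N); pose y k := ysel M (t k) (h k).
have AE k : A k = tr (t k + a) (h k + Phi (t k) (y k)).
  have hl : last set0 (mkseq Bob k.+1) = Bob k by rewrite -nth_last size_mkseq nth_mkseq.
  by lazy beta zeta delta [A]; rewrite size_mkseq hl.
have hP k : translates Phi D0 (t k) (Bob k) -> Bob k = tr (t k) (h k).
  by move=> /translatesP hk; apply: (@xgetPex _ 0 [set h | Bob k = tr (t k) h]).
have [MM0 Mbdd] : M0 <= M /\ lattice_bounded r s M (t 0%N) (h 0%N).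
  apply: (@xgetPex _ 0 [set M | M0 <= M /\ lattice_bounded r s M (t 0%N) (h 0%N)]).
  exact: lattice_bounded_init.
have yP k : good M (t k) (h k) (y k).
  by apply: (@xgetPex _ 0 [set Y | good M (t k) (h k) Y]); apply: goodP.
have tS k : t k.+1 = t k + T by rewrite /t /bob_time /T -natr1; ring.
have legal k : translates Phi D0 (t k) (Bob k) -> alice_legal Phi D0 a b t1 A Bob k.
  move=> /hP eB; split; first by rewrite AE; apply/translatesP; eexists.
  rewrite AE eB => x /flow_translateP[z Dz ->].
  have [sub _] := yP k.
  apply/flow_translateP; exists (Phi a z + y k).
    by apply: sub; apply/flow_translateP; exists z.
  by rewrite weight_flowD weight_flow_add addrAC addrA.
split=> [k legalB|legalB]; first by apply: legal; case: (legalB k (leqnn k)).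
have eB k : Bob k = tr (t k) (h k) by apply: hP; case: (legalB k).
have BA k : Bob k.+1 `<=` A k by case: (legalB k.+1).
have AB k : A k `<=` Bob k by case: (legal k (legalB k).1).
have bdd k : lattice_bounded r s M (t k) (h k).
  elim: k => [//|k IH]; rewrite tS.
  pose Z := Phi (- t k) (h k.+1 - h k).
  have eZ : h k.+1 = h k + Phi (t k) Z by rewrite /Z /Phi weight_flowK addrC subrK.
  rewrite eZ; apply: (yP k).2 => // i q.
  (* The point of Bob's next set given by [c0] lies in [A k]. Comparing its two expressions,
     [Z - y k] is a point of [D0] contracted during [a] minus [c0] contracted during [T], each with
     entries at most [eta / 2]. *)
  have : A k (Phi (t k.+1) c0 + h k.+1).
    by apply: BA; rewrite eB; apply/flow_translateP; exists c0.
  rewrite AE => /flow_translateP[z Dz].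
  rewrite {1}eZ tS /Phi (weight_flowD r s (t k) T) (weight_flowD r s (t k) a).
  move=> /matrixP/(_ i q).
  rewrite !addmxE ![weight_flow r s (t k) _ i q]weight_flowE.
  set u := weight_flow r s T c0 i q; set v := weight_flow r s a z i q; set w := expR _ => e.
  have w0 : 0 < w := expR_gt0 _.
  have -> : Z i q - y k i q = v - u.
    apply: (mulfI (lt0r_neq0 w0)); rewrite !mulrBr; lra.
  apply: le_trans (ler_normB _ _) _.
  have := weight_flow_le l0 lr ls (ltW a0) (hB z i q Dz).
  have := weight_flow_le l0 lr ls (ltW T0) (hB c0 i q Dc0).
  have := smallB a eta (lexx _) eta_gt0 K2; have := smallB T eta aT eta_gt0 K2.
  rewrite -/u -/v; lra.
have tE k : t k + a = (t 0%N + a) + k%:R * T by rewrite /t /bob_time /T mul0r addr0; ring.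
have nest k : A k.+1 `<=` A k := subset_trans (AB k.+1) (BA k).
have [x hx] : exists x, \bigcap_k A k = [set x].
  have := @nested_translates R m n r s lambda (t 0%N + a) T D0
    (fun k => h k + Phi (t k) (y k)) l0 lr ls T0 cD (ex_intro _ _ Dc0).
  have -> : A = fun k => tr (t 0%N + a + k%:R * T) (h k + Phi (t k) (y k)).
    by apply/funext => k; rewrite AE tE.
  by apply => k; have := nest k; rewrite !AE (tE k) (tE k.+1).
exists x => //.
have Bx k : Bob k x by apply: AB; have : (\bigcap_k A k) x by [rewrite hx]; apply.
set N := #|{: 'I_m * 'I_n}|.
have p0 : 0 < (1 + B) ^+ N by rewrite exprn_gt0 // ltr_wpDr.
(* The outcome lies in all of Bob's sets, so its lattice is that of the centre moved by [uni z] with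
   [z] in [D0]; this costs [(1 + B) ^+ N] in the rank one bound. *)
pose eps := expR (- (M * rank_weight R (m + n) 1)) / (1 + B) ^+ N.
have eps0 : 0 < eps by rewrite divr_gt0 ?expR_gt0.
have eps01 : 0 < Num.min eps 1 <= 1 by rewrite lt_min eps0 ltr01 ge_min lexx orbT.
apply: (@Bad_of_bounded R m n r s lambda (Num.min eps 1) (t 0%N) T) => // k v v0.
rewrite ge_min; apply/orP; left.
have -> : t 0%N + k%:R * T = t k by rewrite /t /bob_time mul0r addr0.
have := Bx k; rewrite eB => /flow_translateP[z Dz ex].
have exk : lattice_mx r s (t k) x = uni z *m lattice_mx r s (t k) (h k).
  by rewrite ex /lattice_mx uniD !mulmxA flow_mx_uni.
have full : row_full (map_mx intr v : 'M[R]_(m + n, 1)).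
  by have /cV0Pn[i vi] := v0; apply: (@row_full_col _ _ _ i); rewrite mxE intr_eq0.
have mn1 : (0 < 1 < m + n)%N by rewrite /= -(addn1 1) leq_add.
have h1 := bdd k 1%N v mn1 full.
have hz i q : `|(- z) i q| <= B by rewrite mxE normrN hB.
have [h2 _] := uni_near (uni z *m (lattice_mx r s (t k) (h k) *m map_mx intr v)) B0 hz.
rewrite mulmxA -uniD addNr uni0 mul1mx -/N in h2.
rewrite exk -mulmxA /eps ler_pdivrMr // [leRHS]mulrC; exact: le_trans h1 h2.
Qed.
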